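(* In the stochastic contextual linear bandit setting described in the context, assume that $p(m)>0$ for all $m\in[M]$, that for each $m\in[M]$ the optimal arm $x_m^*=\arg\max_{x\in\mathcal A^m}\langle x,\theta\rangle$ is uniquely defined, and that the policy $\pi$ is consistent. Then $$\liminf_{n\to\infty}\frac{R_\theta^\pi(n)}{\log(n)}\ \ge\ \mathcal C(\theta,\mathcal A^1,\ldots,\mathcal A^M),$$ where $\mathcal C(\theta,\mathcal A^1,\ldots,\mathcal A^M)$ is the optimal value of $$\inf_{\alpha_{x,m}\in[0,\infty]}\ \sum_{m=1}^M\sum_{x\in\mathcal A^m}\alpha_{x,m}\,\Delta_x^m$$ subject to the constraint that, for every context $m\in[M]$ and every suboptimal arm $x\in\mathcal A^m$ (i.e. $\Delta_x^m>0$), $$x^\top\Big(\sum_{m'=1}^M\sum_{y\in\mathcal A^{m'}}\alpha_{y,m'}\,yy^\top\Big)^{-1}x\ \le\ \frac{(\Delta_x^m)^2}{2}.$$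
   Context: Setting (stochastic $K$-armed contextual linear bandit). There are $M$ contexts; for each $m\in[M]=\{1,\dots,M\}$ there is a known finite action set $\mathcal A^m\subset\mathbb R^d$ with $|\mathcal A^m|=K$, such that $\mathcal A^m$ spans $\mathbb R^d$ and $\|x\|_2\le 1$ for all $x\in\bigcup_m\mathcal A^m$. The parameter $\theta\in\mathbb R^d$ is fixed and unknown. For horizon $n$, contexts $c_1,\dots,c_n$ are drawn i.i.d. from a distribution $p$ on $[M]$ (unknown to the learner). In round $t$ the learner sees $c_t$, chooses $X_t\in\mathcal A^{c_t}$ based on past observations and $c_t$ (according to its policy $\pi$, which may know the horizon $n$), and receives $Y_t=\langle X_t,\theta\rangle+\eta_t$, where the $\eta_t$ are independent standard Gaussians. The suboptimality gap is $\Delta_x^m=\max_{y\in\mathcal A^m}\langle y-x,\theta\rangle=\langle x_m^*-x,\theta\rangle$ for $x\in\mathcal A^m$. The regret is $R_\theta^\pi(n)=\mathbb E\big[\sum_{t=1}^n\langle x_{c_t}^*,\theta\rangle-\sum_{t=1}^nY_t\big]$. A policy $\pi$ is consistent if, for all context distributions and all parameters $\theta\in\mathbb R^d$, $R_\theta^\pi(n)=o(n^\varepsilon)$ for all $\varepsilon>0$. Conventions: $\infty\times 0=0$, so $\alpha_{x,m}\Delta_x^m=0$ whenever $\Delta_x^m=0$. The inverse of a matrix with infinite weights is defined by passing to the limit: $x^\top(\sum\alpha_{y,m'}yy^\top)^{-1}x:=\lim_{L\to\infty}x^\top(\sum\min(\alpha_{y,m'},L)yy^\top)^{-1}x$, where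 the truncated matrices are required to be invertible for large $L$. *)

(* Defs.v *)
From HB Require Import structures.
From mathcomp Require Import all_boot all_order all_algebra.
From mathcomp Require Import all_classical all_reals all_analysis.
From mathcomp Require Import measurable_realfun.

Set Implicit Arguments.
Unset Strict Implicit.
Unset Printing Implicit Defensive.

Import Order.TTheory GRing.Theory Num.Theory.
Import numFieldNormedType.Exports.

Local Open Scope classical_set_scope.
Local Open Scope ring_scope.

(* Contexts are indexed by 'I_M.+1 and the arms of each context by 'I_K.+1:
   there is at least one of each, and a [measurableType] is inhabited. *)
HB.instance Definition _ (n : nat) := isPointed.Build 'I_n.+1 ord0.
HB.instance Definition _ (n : nat) :=
  @isMeasurable.Build default_measure_display 'I_n.+1
    discrete_measurable discrete_measurable0
    discrete_measurableC discrete_measurableU.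

Section semidirect_product.
Context d1 d2 (T1 : measurableType d1) (T2 : measurableType d2) (R : realType).
Local Open Scope ereal_scope.

(* Joint law of (x, y) when x has law [P] and y has law [k x] given x. *)
Definition semidirect (P : probability T1 R) (k : R.-pker T1 ~> T2)
    (A : set (T1 * T2)) : \bar R :=
  \int[P]_x k x (xsection A x).

Variables (P : probability T1 R) (k : R.-pker T1 ~> T2).

Let semidirect0 : semidirect P k set0 = 0.
Proof.
by rewrite /semidirect integral0_eq// => x _; rewrite xsection0 measure0.
Qed.

Let semidirect_ge0 A : 0 <= semidirect P k A.
Proof. exact: integral_ge0. Qed.

Let semidirect_sigma_additive : semi_sigma_additive (semidirect P k).
Proof.
move=> F mF tF mUF.
rewrite [X in _ --> X](_ : _ =
    \int[P]_x \sum_(n <oo) k x (xsection (F n) x)); last first.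
  apply: eq_integral => x _; rewrite xsection_bigcup.
  apply/esym/cvg_lim => //.
  apply: measure_semi_sigma_additive.
  - by move=> n; exact: measurable_xsection.
  - exact: trivIset_xsection.
  - by apply: bigcup_measurable => n _; exact: measurable_xsection.
apply/cvg_closeP; split.
  by apply: is_cvg_nneseries => n _ _; exact: integral_ge0.
rewrite closeE// integral_nneseries// => n.
by apply: measurable_fun_xsection_finite_kernel; rewrite inE.
Qed.

HB.instance Definition _ := isMeasure.Build _ _ _ (semidirect P k)
  semidirect0 semidirect_ge0 semidirect_sigma_additive.

Let semidirectT : semidirect P k setT = 1.
Proof.
rewrite /semidirect (eq_integral (cst 1)); last first.
  by move=> x _; rewrite xsectionE preimage_setT prob_kernel.
rewrite integral_cst// mul1e; exact: probability_setT.
Qed.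

HB.instance Definition _ :=
  Measure_isProbability.Build _ _ _ (semidirect P k) semidirectT.

End semidirect_product.

Section geometry.
Context (R : realType) (d M K : nat).
Implicit Types (A : 'I_M.+1 -> 'I_K.+1 -> 'cV[R]_d) (theta : 'cV[R]_d).

Definition dot (x y : 'cV[R]_d) : R := (x^T *m y) 0 0.

(* The norm that the library puts on matrices is the supremum norm. *)
Definition norm2 (x : 'cV[R]_d) : R := Num.sqrt (dot x x).

Definition best A theta m : R := sup (range (fun j => dot (A m j) theta)).

Definition gap A theta m k : R :=
  sup (range (fun j => dot (A m j - A m k) theta)).

End geometry.

Section interaction.
Context (R : realType) (d M K : nat).

(* (context, arm, reward) *)
Definition round : Type := 'I_M.+1 * 'I_K.+1 * measurableTypeR R.
HB.instance Definition _ := Measurable.on round.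

(* The most recent round comes first. *)
Notation history t := (t.-tuple round).

(* [pi n t (h, c)] is the law of the arm played in the round that follows the
   t rounds recorded in [h], when the horizon is n and the context is c. *)
Definition policy : Type :=
  forall n t : nat, R.-pker (history t * 'I_M.+1) ~> 'I_K.+1.

Variables (A : 'I_M.+1 -> 'I_K.+1 -> 'cV[R]_d) (theta : 'cV[R]_d).

Section kernels.
Variable t : nat.

Definition context_kernel (p : probability 'I_M.+1 R) :
    R.-pker (history t) ~> 'I_M.+1 :=
  kprobability (measurable_cst (p : pprobability 'I_M.+1 R)).

(* Adding standard Gaussian noise to <x, theta> gives the law N(<x, theta>, 1). *)
Definition reward_kernel (z : history t * 'I_M.+1 * 'I_K.+1) :
    {measure set (measurableTypeR R) -> \bar R} :=
  normal_prob (dot (A z.1.2 z.2) theta) 1.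

Let measurable_reward U : measurable U ->
  measurable_fun [set: history t * 'I_M.+1 * 'I_K.+1]
    ((reward_kernel ^~ U) : _ -> \bar R).
Proof.
move=> mU; pose f (i : 'I_M.+1 * 'I_K.+1) :=
  normal_prob (dot (A i.1 i.2) theta) 1 U.
rewrite (_ : (fun _ => _) = f \o (fun z => (z.1.2, z.2)))//.
apply: (@measurableT_comp _ _ _ _ _ _ f); last first.
  apply: measurable_fun_pair => //.
  exact: (measurableT_comp measurable_snd measurable_fst).
move=> _ Y mY; rewrite setTI; apply: countable_measurable; last exact: countableP.
case=> i j; rewrite (_ : [set (i, j)] = [set i] `*` [set j]); last first.
  by apply/seteqP; split => [_ -> //|[? ?] /= [-> ->]].
exact: measurableX.
Qed.

HB.instance Definition _ :=
  isKernel.Build _ _ _ _ R reward_kernel measurable_reward.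

Let reward_prob z : reward_kernel z [set: measurableTypeR R] = 1%E.
Proof. exact: probability_setT. Qed.

HB.instance Definition _ :=
  Kernel_isProbability.Build _ _ _ _ R reward_kernel reward_prob.

Definition append_round (z : history t * 'I_M.+1 * 'I_K.+1 * measurableTypeR R)
  : history t.+1 := [tuple of (z.1.1.2, z.1.2, z.2) :: z.1.1.1].

Let measurable_append_round : measurable_fun setT append_round.
Proof.
apply: measurable_cons; last first.
  exact: (measurableT_comp measurable_fst
    (measurableT_comp measurable_fst measurable_fst)).
apply: measurable_fun_pair => //; apply: measurable_fun_pair.
  exact: (measurableT_comp measurable_snd
    (measurableT_comp measurable_fst measurable_fst)).
exact: (measurableT_comp measurable_snd measurable_fst).
Qed.

HB.instance Definition _ :=
  isMeasurableFun.Build _ _ _ _ append_round measurable_append_round.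

End kernels.

(* Law of the first t rounds; given the past, the context is drawn from p, then
   the arm by the policy, then the reward. *)
Fixpoint history_law (p : probability 'I_M.+1 R)
    (pi : forall t, R.-pker (history t * 'I_M.+1) ~> 'I_K.+1) (t : nat) :
    probability (history t) R :=
  if t is t'.+1 then
    distribution
      (semidirect
        (semidirect
          (semidirect (history_law p pi t') (context_kernel t' p))
          (pi t'))
        (@reward_kernel t'))
      (@append_round t')
  else \d_[tuple].

Definition regret (p : probability 'I_M.+1 R) (pi : policy) (n : nat) : \bar R :=
  'E_(history_law p (pi n) n)[fun h =>
    \sum_(z <- h) best A theta z.1.1 - \sum_(z <- h) (z.2 : R)].

End interaction.

Section lower_bound.
Context (R : realType) (d M K : nat).
Implicit Types (A : 'I_M.+1 -> 'I_K.+1 -> 'cV[R]_d) (theta : 'cV[R]_d).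
Implicit Types alpha : 'I_M.+1 -> 'I_K.+1 -> \bar R.

(* [regret] being extended-real valued, the little-o is spelled out. *)
Definition consistent A (pi : policy R M K) : Prop :=
  forall (p : probability 'I_M.+1 R) (theta : 'cV[R]_d) (eps : R), 0 < eps ->
  forall c : R, 0 < c ->
  \forall n \near \oo,
    (`|regret A theta p pi n| <= (c * n%:R `^ eps)%:E)%E.

Definition trunc_design A alpha (L : R) : 'M[R]_d :=
  \sum_m \sum_k
    fine (Order.min (alpha m k) L%:E) *: (A m k *m (A m k)^T).

(* x^T (sum alpha y y^T)^-1 x <= c for weights alpha in [0, +oo]. Once the
   truncated matrices are invertible, the quadratic form is nonincreasing in L,
   so that the limit exists. *)
Definition inv_form_le A alpha (x : 'cV[R]_d) (c : R) : Prop :=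
  (\forall L \near +oo, trunc_design A alpha L \in unitmx) /\
  lim ((x^T *m invmx (trunc_design A alpha L) *m x) 0 0 @[L --> +oo]) <= c.

Definition feasible A theta alpha : Prop :=
  (forall m k, (0 <= alpha m k)%E) /\
  (forall m k, 0 < gap A theta m k ->
    inv_form_le A alpha (A m k) (gap A theta m k ^+ 2 / 2)).

(* In \bar R, +oo * 0 = 0. *)
Definition complexity A theta : \bar R :=
  ereal_inf [set (\sum_m \sum_k alpha m k * (gap A theta m k)%:E)%E
            | alpha in feasible A theta].

End lower_bound.

(* Main.v *)
(* Fix a context m, its optimal arm k and a direction u with <y, u> = 0 for
   every optimal arm y and <x, u> = 1 for a suboptimal arm x of m. Moving the
   parameter to theta + s u with s > Delta_x makes k suboptimal in m. Under
   theta the policy must play k in almost all rounds with context m, under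
   theta + s u it must play k rarely; as both regrets are o(n^eps), the
   Bretagnolle-Huber inequality, applied round by round to the probability of
   playing k, forces the Kullback-Leibler divergence of the two history laws,
   s^2 / 2 * sum_y E[T_y(n)] <y, u>^2, to exceed (1 - eps) ln n - C.

   Let alpha be a limit of E[T_y(n)] / ln n, for suboptimal y, along an
   ultrafilter on horizons at which regret / ln n is close to its liminf. Then
   Delta_x^2 / 2 * sum_y alpha_y <y, u>^2 >= 1 for all such u, and the cost of
   alpha is at most the liminf. Give the optimal arms, which cost nothing, an
   infinite weight. Feasibility follows by duality: x^T H^-1 x is the inverse of
   the minimum of u^T H u over <x, u> = 1, and the minimisers for the truncated
   weights have a limit point, which is orthogonal to all optimal arms. *)

Require Import Defs.
From HB Require Import structures.
From mathcomp Require Import all_boot all_order all_algebra.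
From mathcomp Require Import all_classical all_reals all_analysis.
From mathcomp Require Import measurable_realfun.
From mathcomp Require Import ring lra.

Set Implicit Arguments.
Unset Strict Implicit.
Unset Printing Implicit Defensive.

Import Order.TTheory GRing.Theory Num.Theory.
Import numFieldNormedType.Exports.

Local Open Scope classical_set_scope.
Local Open Scope ring_scope.

(** * Integration against semidirect products and shifted Gaussians *)

Lemma integral_probability_cst d (T : measurableType d) (R : realType)
  (P : probability T R) (r : R) : (\int[P]_x r%:E = r%:E)%E.
Proof.
have /= -> := integral_cst P measurableT r%:E.
by have /= -> := probability_setT P; rewrite mule1.
Qed.

Section semidirect_integral.
Context d1 d2 (T1 : measurableType d1) (T2 : measurableType d2) (R : realType).
Local Open Scope ereal_scope.

(** [semidirect P k] agrees on measurable sets with the composition of [P], viewed as a kernel out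
    of [unit], and the kernel sending x to the law of (x, y) with y drawn from [k x]. The iterated
    integral is then the one of [integral_kcomp]. *)
Lemma ge0_integral_semidirect (P : probability T1 R) (k : R.-pker T1 ~> T2)
    (f : T1 * T2 -> \bar R) :
    (forall z, 0 <= f z) -> measurable_fun setT f ->
  \int[semidirect P k]_z f z = \int[P]_x \int[k x]_y f (x, y).
Proof.
move=> f0 mf.
pose P' : R.-pker unit ~> T1 := kprobability (measurable_cst (P : pprobability T1 R)).
pose k' : R.-spker (unit * T1)%type ~> T2 := kernel.kernel_snd k.
have mpair : measurable_fun [set: unit * T1 * T2] (fun z => (z.1.2, z.2)).
  apply: measurable_fun_pair => //.
  exact: (measurableT_comp measurable_snd measurable_fst).
pose D : R.-pker (unit * T1 * T2)%type ~> (T1 * T2)%type := kdirac mpair.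
pose K : R.-sfker (unit * T1)%type ~> (T1 * T2)%type := k' \; D.
have KE z g : (forall w, 0 <= g w) -> measurable_fun setT g ->
    \int[K z]_w g w = \int[k z.2]_y g (z.2, y).
  move=> g0 mg; rewrite integral_kcomp//; apply: eq_integral => y _.
  by rewrite /D /kdirac /= integral_dirac//= diracT mul1e.
transitivity (\int[kcomp P' K tt]_z f z).
  apply: eq_measure_integral => A mA _.
  rewrite /= /semidirect /kcomp; apply: eq_integral => x _.
  transitivity (\int[K (tt, x)]_w (\1_A w)%:E).
    rewrite KE//=; last exact/measurable_EFinP/measurable_indic.
    transitivity (\int[k x]_y (\1_(xsection A x) y)%:E).
      by rewrite integral_indic ?setIT//; exact: measurable_xsection.
    by apply: eq_integral => y _; rewrite !indicE mem_xsection.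
  by rewrite integral_indic ?setIT.
rewrite integral_kcomp//; apply: eq_integral => x _.
by rewrite KE.
Qed.

End semidirect_integral.

Lemma ge0_integral_ord (R : realType) (n : nat)
    (mu : {measure set 'I_n.+1 -> \bar R}) (f : 'I_n.+1 -> \bar R) :
    (forall i, 0 <= f i)%E ->
  (\int[mu]_i f i = \sum_i mu [set i] * f i)%E.
Proof.
move=> f0; have mI (g : 'I_n.+1 -> \bar R) D : measurable_fun D g by [].
transitivity (\int[mu]_i \sum_(j <- index_enum 'I_n.+1)
    (f j * (\1_[set j] i)%:E))%E.
  apply: eq_integral => i _; rewrite (bigD1 i)//= big1 ?adde0.
    by rewrite indicE mem_set// mule1.
  move=> j ji; rewrite indicE memNset ?mule0//= => /eqP.
  by rewrite eq_sym (negbTE ji).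
rewrite ge0_integral_sum//; last first.
  by move=> j x _; rewrite mule_ge0// lee_fin.
by apply: eq_bigr => j _; rewrite ge0_integralZl// integral_indic// setIT muleC.
Qed.

Section normal_shift.
Context (R : realType).
Local Open Scope ereal_scope.
Local Notation N m := (normal_prob m (1 : R)).
Implicit Types (f : R -> \bar R) (m s y : R).

(** The Radon-Nikodym derivative and the Gaussian density have equal integrals over all measurable
    sets, hence agree almost everywhere. *)
Lemma ge0_integral_normal m s f : (forall y, 0 <= f y) ->
    measurable_fun setT f ->
  \int[normal_prob m s]_y f y =
  \int[lebesgue_measure]_y (f y * (normal_pdf m s y)%:E).
Proof.
move=> f0 mf.
have dom := normal_prob_dominates m s.
rewrite -(Radon_Nikodym_SigmaFinite.change_of_variables dom f0 measurableT mf).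
have RNint := Radon_Nikodym_SigmaFinite.f_integrable dom.
have mRN := measurable_int _ RNint.
have mpdf : measurable_fun [set: measurableTypeR R] (EFin \o normal_pdf m s).
  by apply/measurable_EFinP; exact: measurable_normal_pdf.
apply: ae_eq_integral => //; try exact: emeasurable_funM.
have : ae_eq lebesgue_measure setT
    (Radon_Nikodym_SigmaFinite.f (normal_prob m s) lebesgue_measure)
    (EFin \o normal_pdf m s).
  apply: integral_ae_eq => // E _ mE.
  by rewrite -Radon_Nikodym_SigmaFinite.f_integral.
by apply: filterS => x /= /(_ Logic.I) ->.
Qed.

(** The exponential is the ratio of the two unit-variance densities. *)
Lemma ge0_integral_normal_shift m s f : (forall y, 0 <= f y) ->
    measurable_fun setT f ->
  \int[N (m + s)]_y f y =
  \int[N m]_y (f y * (expR (s * (y - m) - s ^+ 2 / 2))%:E).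
Proof.
move=> f0 mf; have mexp : measurable_fun setT
    (fun y : R => (expR (s * (y - m) - s ^+ 2 / 2))%:E).
  apply/measurable_EFinP; apply: measurableT_comp => //.
  apply: measurable_funB => //; apply: measurable_funM => //.
  exact: measurable_funB.
rewrite (ge0_integral_normal (m + s) 1 f0 mf).
rewrite (ge0_integral_normal m 1 _ (emeasurable_funM mf mexp)); last first.
  by move=> y; rewrite mule_ge0// lee_fin expR_ge0.
apply: eq_integral => y _; rewrite -muleA -EFinM; congr (_ * _%:E).
rewrite /normal_pdf oner_eq0 /normal_fun mulrCA -expRD.
by congr (_ * expR _)%R; field.
Qed.

Lemma integral_normal_exp m s :
  \int[N m]_y (expR (s * (y - m)))%:E = (expR (s ^+ 2 / 2))%:E.
Proof.
have := @ge0_integral_normal_shift m s (cst (expR (s ^+ 2 / 2))%:E).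
rewrite integral_cst//= probability_setT mule1 => ->//.
by apply: eq_integral => y _; rewrite -EFinM -expRD; congr (expR _)%:E; ring.
Qed.

Lemma integrable_normal_exp m s :
  (N m).-integrable setT (fun y => (expR (s * (y - m)))%:E).
Proof.
apply/integrableP; split.
  apply/measurable_EFinP; apply: measurableT_comp => //.
  by apply: measurable_funM => //; exact: measurable_funB.
under eq_integral do rewrite gee0_abs ?lee_fin ?expR_ge0//.
by rewrite integral_normal_exp ltry.
Qed.

(** Domination: |x| <= e^x + e^(-x), and both exponentials are integrable. *)
Lemma integrable_normal_center m :
  (N m).-integrable setT (fun y => (y - m)%:E).
Proof.
have h := integrableD measurableT (integrable_normal_exp m 1)
  (integrable_normal_exp m (-1)).
apply: le_integrable h => //; first exact/measurable_EFinP/measurable_funB.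
move=> y _; rewrite /= lee_fin mul1r mulN1r.
rewrite (ger0_norm (addr_ge0 (expR_ge0 _) (expR_ge0 _))).
rewrite ler_norml; have := expR_ge1Dx (y - m); have := expR_ge1Dx (- (y - m)).
by have := expR_ge0 (y - m); have := expR_ge0 (- (y - m)); lra.
Qed.

(** The mean is read off the moment generating function: integrating 1 + t x <= e^(t x) gives t mu
    <= e^(t^2 / 2) - 1 for every t, which is of second order in t and forces mu = 0. *)
Lemma integral_normal_center m : \int[N m]_y (y - m)%:E = 0.
Proof.
have ic := integrable_normal_center m.
have /fineK := integrable_fin_num measurableT ic.
set mu := fine _ => muE; rewrite -muE; congr EFin.
have key t : (t * mu <= expR (t ^+ 2 / 2) - 1)%R.
  have : \int[N m]_y (t%:E * (y - m)%:E + 1) <= \int[N m]_y (expR (t * (y - m)))%:E.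
    apply: le_integral => //.
    - apply: integrableD => //; first exact: integrableZl.
      exact: finite_measure_integrable_cst.
    - exact: integrable_normal_exp.
    - by move=> y _; rewrite -EFinM -EFinD lee_fin addrC expR_ge1Dx.
  rewrite integralD//; last 2 first.
    exact: integrableZl.
    exact: finite_measure_integrable_cst.
  have -> : \int[N m]_y 1 = 1 by rewrite integral_cst//= mul1e probability_setT.
  rewrite integralZl// -muE.
  by rewrite integral_normal_exp -EFinM -EFinD lee_fin; lra.
(* This [t] has the sign of [mu] and t^2 <= 1, so that e^(t^2 / 2) - 1 <= t^2, whereas t mu = t^2 (1
   + |mu|) exceeds t^2. *)
apply/eqP; apply: contraT => mu0; pose t := (mu / (1 + `|mu|))%R.
have n0 : (0 < `|mu|)%R by rewrite normr_gt0.
have muE' : mu = (t * (1 + `|mu|))%R by rewrite /t divfK// gt_eqF// addr_gt0.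
have t1 : (t ^+ 2 <= 1)%R.
  rewrite -real_normK ?num_real// expr_le1// normrM normfV.
  by rewrite (@ger0_norm _ (1 + `|mu|)%R) ?ler_pdivrMr//; lra.
have t0 : (0 < t ^+ 2)%R.
  by rewrite exprn_even_gt0//= mulf_neq0// invr_neq0// gt_eqF//; lra.
suff : (t * mu <= t ^+ 2)%R by rewrite {1}muE' mulrA -expr2; nra.
apply: le_trans (key t) _.
have := expR_ge1Dx (- (t ^+ 2 / 2)); rewrite expRN => e1.
have e2 : (expR (t ^+ 2 / 2) <= (1 - t ^+ 2 / 2)^-1)%R.
  by rewrite -[leLHS]invrK lef_pV2 ?posrE ?invr_gt0 ?expR_gt0//; lra.
suff : ((1 - t ^+ 2 / 2)^-1 <= 1 + t ^+ 2)%R by lra.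
by rewrite -[leLHS]mul1r ler_pdivrMr; nra.
Qed.

End normal_shift.

(** * Expected numbers of plays *)

Section history.
Context (R : realType) (d M K : nat).
Variable A : 'I_M.+1 -> 'I_K.+1 -> 'cV[R]_d.
Notation round := (round R M K).
Notation history t := (t.-tuple round).
Variables (p : probability 'I_M.+1 R)
  (pi : forall t, R.-pker (history t * 'I_M.+1) ~> 'I_K.+1).
Local Open Scope ereal_scope.
Local Notation N theta c a := (normal_prob (dot (A c a) theta) (1 : R)).
Local Notation law theta t := (history_law A theta p pi t).
Local Notation snoc h c a y := (append_round (h, c, a, y)).

(** Contexts and arms are finite and discrete: [g] is a finite sum of indicators of the cells
    [D c a] times functions of the reward. *)
Lemma measurable_round (g : round -> R) :
    (forall c a, measurable_fun setT (fun y : measurableTypeR R => g (c, a, y))) ->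
  measurable_fun setT g.
Proof.
move=> mg; pose D c a := [set z : round | z.1 = (c, a)].
have mD c a : measurable (D c a).
  rewrite (_ : D c a = ([set c] `*` [set a]) `*` setT); last first.
    by apply/seteqP; split => [[[? ?] ?] /= [-> ->]|[[? ?] ?] /= [[-> ->]]].
  by apply: measurableX => //; apply: measurableX.
rewrite (_ : g = fun z => \sum_c \sum_a (\1_(D c a) z * g (c, a, z.2)))%R; last first.
  apply/funext => -[[c a] y].
  rewrite (bigD1 c)//= [X in (_ + X)%R]big1 ?addr0; last first.
    move=> i ic; rewrite big1// => j _; rewrite indicE memNset ?mul0r//.
    by rewrite /D /= => -[] ci _; rewrite ci eqxx in ic.
  rewrite (bigD1 a)//= [X in (_ + X)%R]big1 ?addr0; last first.
    move=> j ja; rewrite indicE memNset ?mul0r//.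
    by rewrite /D /= => -[] aj; rewrite aj eqxx in ja.
  by rewrite indicE mem_set ?mul1r.
apply: measurable_sum => c; apply: measurable_sum => a.
apply: measurable_funM; first exact: measurable_indic.
exact: (measurableT_comp (mg c a)).
Qed.

Lemma measurable_history_sum t (g : round -> R) : measurable_fun setT g ->
  measurable_fun setT (fun h : history t => \sum_(z <- h) g z)%R.
Proof.
move=> mg; under eq_fun do rewrite big_tuple.
apply: measurable_sum => i; apply: (measurableT_comp mg).
exact: measurable_tnth.
Qed.

Section one_step.
Variables (theta : 'cV[R]_d) (t : nat).

Lemma measurable_append : measurable_fun setT
  (@append_round R M K t).
Proof. exact: measurable_funP. Qed.

(** The conditional expectation of [f] given the first t rounds. *)
Definition step (f : history t.+1 -> \bar R) (h : history t) : \bar R :=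
  \int[p]_c \int[pi t (h, c)]_a \int[N theta c a]_y f (snoc h c a y).

Lemma stepE f h : (forall h, 0 <= f h) -> step f h =
  \sum_c \sum_a p [set c] * pi t (h, c) [set a] *
    \int[N theta c a]_y f (snoc h c a y).
Proof.
move=> f0; have i0 c a : 0 <= \int[N theta c a]_y f (snoc h c a y).
  exact: integral_ge0.
rewrite /step ge0_integral_ord; last by move=> c; exact: integral_ge0.
apply: eq_bigr => c _; rewrite ge0_integral_ord// ge0_sume_distrr//; last first.
  by move=> a _; rewrite mule_ge0.
by apply: eq_bigr => a _; rewrite muleA.
Qed.

Lemma step_ge0 f h : (forall h, 0 <= f h) -> 0 <= step f h.
Proof. by move=> f0; do 3! (apply: integral_ge0 => ? _). Qed.

Section measurable_step.
Variables (f : history t.+1 -> \bar R).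
Hypotheses (f0 : forall h, 0 <= f h) (mf : measurable_fun setT f).

(** The reward, the arm and the context are integrated out one at a time, each stage being the
    integral of a measurable function against a kernel. *)
Let f1 z := f (@append_round R M K t z).
Let mf1 : measurable_fun setT f1.
Proof. exact: measurableT_comp mf measurable_append. Qed.
Let f2 := kfcomp (@reward_kernel R d M K A theta t) f1.
Let mf2 : measurable_fun setT f2.
Proof.
apply: (@measurable_kfcomp _ _ _ _ R (@reward_kernel R d M K A theta t) f1 mf1).
by move=> z; exact: f0.
Qed.
Let f20 z : 0 <= f2 z. Proof. by apply: integral_ge0 => y _; exact: f0. Qed.
Let f3 := kfcomp (pi t) f2.
Let mf3 : measurable_fun setT f3.
Proof. exact: (@measurable_kfcomp _ _ _ _ R (pi t) f2 mf2 f20). Qed.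
Let f30 z : 0 <= f3 z. Proof. by apply: integral_ge0 => y _; exact: f20. Qed.

Lemma measurable_step : measurable_fun setT (step f).
Proof. exact: (@measurable_kfcomp _ _ _ _ R (context_kernel K t p) f3 mf3 f30). Qed.

Lemma ge0_integral_historyS :
  \int[law theta t.+1]_h f h = \int[law theta t]_h step f h.
Proof.
rewrite /= ge0_integral_distribution//.
rewrite (ge0_integral_semidirect _ (@reward_kernel R d M K A theta t)
  (fun=> f0 _) mf1).
rewrite (ge0_integral_semidirect _ (pi t) f20 mf2).
by rewrite (ge0_integral_semidirect _ (context_kernel K t p) f30 mf3).
Qed.

End measurable_step.
End one_step.

Lemma history_law0 theta : law theta 0 = \d_[tuple] :> probability (history 0) R.
Proof. by []. Qed.

(* Probability that the context is c and the arm is a in round t, counted from 0;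
   its sum [pulls] over t < n is the expected number E[T(n)] of such rounds. *)
Definition play theta t c a : \bar R :=
  \int[law theta t]_h (p [set c] * pi t (h, c) [set a]).

Lemma measurable_play t c a : measurable_fun setT
  (fun h : history t => p [set c] * pi t (h, c) [set a]).
Proof.
apply: emeasurable_funM => //.
exact: (measurableT_comp (measurable_kernel (pi t) [set a] _)).
Qed.

Lemma play_ge0 theta t c a : 0 <= play theta t c a.
Proof. by apply: integral_ge0 => h _; rewrite mule_ge0. Qed.

Lemma play_fin_num theta t c a : play theta t c a \is a fin_num.
Proof.
rewrite ge0_fin_numE ?play_ge0//; apply: (@le_lt_trans _ _ 1); last exact: ltry.
apply: (@le_trans _ _ (\int[law theta t]_h 1)).
  apply: ge0_le_integral => //.
  - by move=> h _; rewrite mule_ge0.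
  - exact: measurable_play.
  move=> h _; apply: (@le_trans _ _ (1 * 1)); last by rewrite mule1.
  apply: lee_pmul => //; first exact: probability_le1.
  by rewrite -(@prob_kernel _ _ _ _ _ (pi t) (h, c)); apply: le_measure; rewrite ?inE.
by rewrite integral_cst//= mul1e probability_setT.
Qed.

(** Both sides are [step] of the constant 1, by [stepE] and by direct integration. *)
Lemma sum_weights t (h : history t) :
  \sum_c \sum_a p [set c] * pi t (h, c) [set a] = 1.
Proof.
have := @stepE 0%R t (cst 1) h (fun=> lee01).
under [in X in _ = X -> _]eq_bigr do under eq_bigr do
  rewrite integral_cst//= mul1e probability_setT mule1.
move=> <-; rewrite /step.
under eq_integral do under eq_integral do
  rewrite integral_cst//= mul1e probability_setT.
under eq_integral do rewrite integral_cst//= mul1e prob_kernel.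
by rewrite integral_cst//= mul1e probability_setT.
Qed.

Definition pulls theta n c a : R := (\sum_(i < n) fine (play theta i c a))%R.

Lemma pulls_ge0 theta n c a : (0 <= pulls theta n c a)%R.
Proof. by apply: sumr_ge0 => i _; rewrite fine_ge0// play_ge0. Qed.

Lemma pullsS theta n c a :
  (pulls theta n.+1 c a)%:E = (pulls theta n c a)%:E + play theta n c a.
Proof. by rewrite /pulls big_ord_recr /= EFinD fineK// play_fin_num. Qed.

(** A form of Wald's identity, by induction on t: given the context and the arm, the mean of [g]
    over the new round does not depend on the past. *)
Lemma ge0_integral_history_sum theta t (g : round -> R) :
    (forall z, (0 <= g z)%R) -> measurable_fun setT g ->
  \int[law theta t]_h (\sum_(z <- h) g z)%:E =
  \sum_c \sum_a (pulls theta t c a)%:E * \int[N theta c a]_y (g (c, a, y))%:E.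
Proof.
move=> g0 mg.
have mS n : measurable_fun setT (fun h : history n => (\sum_(z <- h) g z)%:E).
  by apply/measurable_EFinP; exact: measurable_history_sum.
have mgca c a : measurable_fun setT (fun y : measurableTypeR R => (g (c, a, y))%:E).
  apply/measurable_EFinP; apply: (measurableT_comp mg).
  exact: (@pair1_measurable _ _ ('I_M.+1 * 'I_K.+1)%type).
have G0 c a : 0 <= \int[N theta c a]_y (g (c, a, y))%:E.
  by apply: integral_ge0 => y _; rewrite lee_fin.
elim: t => [|t IH].
  rewrite /= integral_dirac//=; last first.
    exact: mS.
  rewrite diracT mul1e big_nil big1// => c _; rewrite big1// => a _.
  by rewrite /pulls big_ord0 mul0e.
have S0 (h : history t) : (0 <= \sum_(z <- h) g z)%R by apply: sumr_ge0.
rewrite ge0_integral_historyS; last 2 first.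
  by move=> h; rewrite lee_fin; apply: sumr_ge0.
  exact: mS.
transitivity (\int[law theta t]_h ((\sum_(z <- h) g z)%:E +
    \sum_c \sum_a p [set c] * pi t (h, c) [set a] *
       \int[N theta c a]_y (g (c, a, y))%:E)).
  apply: eq_integral => h _; rewrite stepE; last first.
    by move=> h'; rewrite lee_fin; apply: sumr_ge0.
  (* The past sum is multiplied by the total weight 1, so that it splits over the pairs (c, a) as
     the contribution of the new round does. *)
  rewrite -[X in X + _]mule1 -(sum_weights h).
  rewrite ge0_sume_distrr; last first.
    by move=> c _; apply: sume_ge0 => a _; rewrite mule_ge0.
  rewrite -big_split; apply: eq_bigr => c _.
  rewrite ge0_sume_distrr; last by move=> a _; rewrite mule_ge0.
  rewrite -big_split; apply: eq_bigr => a _.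
  rewrite /= [X in _ = X + _]muleC -ge0_muleDr ?lee_fin//; congr (_ * _).
  under eq_integral do rewrite /= big_cons EFinD addeC.
  rewrite ge0_integralD//; last 2 first.
    by move=> y _; rewrite lee_fin.
    by move=> y _; rewrite lee_fin.
  by rewrite integral_cst//= probability_setT mule1.
rewrite ge0_integralD//; last 4 first.
- by move=> h _; rewrite lee_fin.
- exact: mS.
- by move=> h _; apply: sume_ge0 => c _; apply: sume_ge0 => a _; rewrite !mule_ge0.
- apply: emeasurable_sum => c; apply: emeasurable_sum => a.
  by apply: emeasurable_funM => //; exact: measurable_play.
rewrite IH ge0_integral_sum//; last 2 first.
- move=> c; apply: emeasurable_sum => a.
  by apply: emeasurable_funM => //; exact: measurable_play.
- by move=> c h _; apply: sume_ge0 => a _; rewrite !mule_ge0.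
rewrite -big_split; apply: eq_bigr => c _.
rewrite ge0_integral_sum//; last 2 first.
- by move=> a; apply: emeasurable_funM => //; exact: measurable_play.
- by move=> a h _; rewrite !mule_ge0.
rewrite -big_split; apply: eq_bigr => a _.
rewrite ge0_integralZr//; last 2 first.
- exact: measurable_play.
- by move=> h _; rewrite mule_ge0.
rewrite /= -/(play theta t c a) pullsS.
by rewrite [RHS]ge0_muleDl ?lee_fin ?pulls_ge0 ?play_ge0.
Qed.

End history.

(** * Suboptimality gaps and the decomposition of the regret *)

Section dot_gap.
Context (R : realType) (d : nat).
Implicit Types x y z : 'cV[R]_d.

Lemma dotDr x y z : dot x (y + z) = dot x y + dot x z.
Proof. by rewrite /dot mulmxDr mxE. Qed.

Lemma dotBl x y z : dot (x - y) z = dot x z - dot y z.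
Proof. by rewrite /dot linearB mulmxBl !mxE. Qed.

Lemma dotZr (a : R) x y : dot x (a *: y) = a * dot x y.
Proof. by rewrite /dot -scalemxAr mxE. Qed.

Lemma sup_range_max (T : Type) (f : T -> R) (k : T) :
  (forall j, f j <= f k) -> sup (range f) = f k.
Proof.
move=> fk; apply/eqP; rewrite eq_le; apply/andP; split.
  by apply: ge_sup; [exists (f k), k|move=> _ [j _ <-]].
by apply: ub_le_sup; [exists (f k) => _ [j _ <-]|exists k].
Qed.

Context (M K : nat).
Implicit Types (A : 'I_M.+1 -> 'I_K.+1 -> 'cV[R]_d) (theta : 'cV[R]_d).

Lemma best_attained A theta m :
  exists k, forall j, dot (A m j) theta <= dot (A m k) theta.
Proof.
exists [arg max_(k > ord0) dot (A m k) theta]%O => j.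
by case: arg_maxP => // i _; apply.
Qed.

Lemma gapE A theta m k : gap A theta m k = best A theta m - dot (A m k) theta.
Proof.
have [i im] := best_attained A theta m.
rewrite /gap /best (@sup_range_max _ (fun j => dot (A m j) theta) i)//.
rewrite (@sup_range_max _ (fun j => dot (A m j - A m k) theta) i) ?dotBl//.
by move=> j; rewrite !dotBl lerB.
Qed.

Lemma dot_le_best A theta m k : dot (A m k) theta <= best A theta m.
Proof.
have [i im] := best_attained A theta m.
by rewrite /best (@sup_range_max _ (fun j => dot (A m j) theta) i).
Qed.

Lemma gap_ge0 A theta m k : 0 <= gap A theta m k.
Proof. by rewrite gapE subr_ge0 dot_le_best. Qed.

End dot_gap.

(** The summands of the regret and of the log-likelihood ratio are both of this shape, a drift plus
    a multiple of the noise. *)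
Lemma integrable_normal_affine (R : realType) (m a b : R) :
  (normal_prob m 1).-integrable setT (fun y => (a + b * (y - m))%:E).
Proof.
under eq_fun do rewrite EFinD EFinM.
apply: integrableD => //; first exact: finite_measure_integrable_cst.
by apply: integrableZl => //; exact: integrable_normal_center.
Qed.

Lemma integral_normal_affine (R : realType) (m a b : R) :
  (\int[normal_prob m 1]_y (a + b * (y - m))%:E = a%:E)%E.
Proof.
have ic := integrable_normal_center m.
under eq_integral do rewrite EFinD EFinM.
rewrite integralD//; last 2 first.
  exact: finite_measure_integrable_cst.
  exact: integrableZl.
rewrite integralZl// integral_normal_center mule0 adde0.
by rewrite integral_probability_cst.
Qed.

Section history_sum.
Context (R : realType) (d M K : nat).
Variable A : 'I_M.+1 -> 'I_K.+1 -> 'cV[R]_d.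
Notation round := (round R M K).
Notation history t := (t.-tuple round).
Variables (p : probability 'I_M.+1 R)
  (pi : forall t, R.-pker (history t * 'I_M.+1) ~> 'I_K.+1).
Local Open Scope ereal_scope.
Local Notation N theta c a := (normal_prob (dot (A c a) theta) (1 : R)).
Local Notation law theta t := (history_law A theta p pi t).
Local Notation pulls := (pulls A p pi).
Variables (theta : 'cV[R]_d) (t : nat).

Let ge0_history_sum (g : round -> R) (G : 'I_M.+1 -> 'I_K.+1 -> R) :
    (forall z, (0 <= g z)%R) -> measurable_fun setT g ->
    (forall c a, \int[N theta c a]_y (g (c, a, y))%:E = (G c a)%:E) ->
  (law theta t).-integrable setT (fun h => (\sum_(z <- h) g z)%:E) /\
  \int[law theta t]_h (\sum_(z <- h) g z)%:E =
  (\sum_c \sum_a pulls theta t c a * G c a)%:E.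
Proof.
move=> g0 mg gG; have E : \int[law theta t]_h (\sum_(z <- h) g z)%:E =
    (\sum_c \sum_a pulls theta t c a * G c a)%:E.
  rewrite ge0_integral_history_sum// -sumEFin; apply: eq_bigr => c _.
  by rewrite -sumEFin; apply: eq_bigr => a _; rewrite gG.
split => //; apply/integrableP; split.
  by apply/measurable_EFinP; exact: measurable_history_sum.
under eq_integral do rewrite gee0_abs ?lee_fin ?sumr_ge0//.
by rewrite E ltry.
Qed.

(** The nonnegative case is applied to the positive and negative parts [g1] and [g2], whose means
    are finite by integrability. *)
Lemma integral_history_sum (g : round -> R) (G : 'I_M.+1 -> 'I_K.+1 -> R) :
    measurable_fun setT g ->
    (forall c a, (N theta c a).-integrable setT (fun y => (g (c, a, y))%:E)) ->
    (forall c a, \int[N theta c a]_y (g (c, a, y))%:E = (G c a)%:E) ->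
  (law theta t).-integrable setT (fun h => (\sum_(z <- h) g z)%:E) /\
  \int[law theta t]_h (\sum_(z <- h) g z)%:E =
  (\sum_c \sum_a pulls theta t c a * G c a)%:E.
Proof.
move=> mg ig gG.
pose g1 z := Num.max (g z) 0%R; pose g2 z := Num.max (- g z)%R 0%R.
have g10 z : (0 <= g1 z)%R by rewrite le_max lexx orbT.
have g20 z : (0 <= g2 z)%R by rewrite le_max lexx orbT.
have gE z : g z = (g1 z - g2 z)%R.
  rewrite /g1 /g2 !maxEle oppr_le0 !fun_if.
  by case: leP => h1; case: leP => h2; lra.
have mg1 : measurable_fun setT g1 by apply: measurable_maxr.
have mg2 : measurable_fun setT g2.
  by apply: measurable_maxr => //; exact: measurableT_comp.
have i1 c a : (N theta c a).-integrable setT (fun y => (g1 (c, a, y))%:E).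
  apply: le_integrable (ig c a) => //.
    apply/measurable_EFinP; apply: (measurableT_comp mg1).
    exact: (@pair1_measurable _ _ ('I_M.+1 * 'I_K.+1)%type).
  by move=> y _; rewrite /= lee_fin ger0_norm// /g1 ge_max ler_norm normr_ge0.
have i2 c a : (N theta c a).-integrable setT (fun y => (g2 (c, a, y))%:E).
  apply: le_integrable (ig c a) => //.
    apply/measurable_EFinP; apply: (measurableT_comp mg2).
    exact: (@pair1_measurable _ _ ('I_M.+1 * 'I_K.+1)%type).
  move=> y _; rewrite /= lee_fin ger0_norm// /g2 ge_max -normrN.
  by rewrite ler_norm normr_ge0.
pose G1 c a := fine (\int[N theta c a]_y (g1 (c, a, y))%:E).
pose G2 c a := fine (\int[N theta c a]_y (g2 (c, a, y))%:E).
have gG1 c a : \int[N theta c a]_y (g1 (c, a, y))%:E = (G1 c a)%:E.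
  by rewrite fineK//; exact: integrable_fin_num (i1 c a).
have gG2 c a : \int[N theta c a]_y (g2 (c, a, y))%:E = (G2 c a)%:E.
  by rewrite fineK//; exact: integrable_fin_num (i2 c a).
have GE c a : G c a = (G1 c a - G2 c a)%R.
  apply: EFin_inj; rewrite -gG EFinB -gG1 -gG2.
  rewrite -(integralB measurableT (i1 c a) (i2 c a)).
  by apply: eq_integral => y _; rewrite gE EFinB.
have [I1 E1] := ge0_history_sum g10 mg1 gG1.
have [I2 E2] := ge0_history_sum g20 mg2 gG2.
have SE (h : history t) : (\sum_(z <- h) g z)%:E =
    (\sum_(z <- h) g1 z)%:E - (\sum_(z <- h) g2 z)%:E.
  by rewrite -EFinB -sumrB; congr EFin; apply: eq_bigr => z _.
rewrite (_ : (fun h : history t => (\sum_(z <- h) g z)%:E) = fun h : history t =>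
  (\sum_(z <- h) g1 z)%:E - (\sum_(z <- h) g2 z)%:E); last exact/funext.
split; first exact: (integrableB measurableT I1 I2).
rewrite integralB// E1 E2 -EFinB; congr EFin; rewrite -sumrB.
apply: eq_bigr => c _; rewrite -sumrB.
by apply: eq_bigr => a _; rewrite GE mulrBr.
Qed.

End history_sum.

(** In each round the best mean minus the reward is the gap minus the noise, and the noise is
    centred. *)
Lemma regretE (R : realType) (d M K : nat)
    (A : 'I_M.+1 -> 'I_K.+1 -> 'cV[R]_d) theta p (pi : policy R M K) n :
  regret A theta p pi n =
  (\sum_c \sum_a pulls A p (pi n) theta n c a * gap A theta c a)%:E.
Proof.
pose g (z : round R M K) : R := best A theta z.1.1 - (z.2 : R).
pose m c a := dot (A c a) theta.
have gE c a : (fun y => (g (c, a, y))%:E) =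
    (fun y => (gap A theta c a + -1 * (y - m c a))%:E).
  by apply/funext => y; rewrite /g /= gapE -/(m c a); congr EFin; ring.
have [] := @integral_history_sum R d M K A p (pi n) theta n g (gap A theta).
- by apply: measurable_round => c a; rewrite /g /=; exact: measurable_funB.
- by move=> c a; rewrite gE; exact: integrable_normal_affine.
- by move=> c a; rewrite gE; exact: integral_normal_affine.
move=> _ <-; rewrite /regret unlock; apply: eq_integral => h _ /=.
by rewrite -sumrB.
Qed.

(** * Change of measure *)

Section change_of_measure.
Context (R : realType) (d M K : nat).
Variable A : 'I_M.+1 -> 'I_K.+1 -> 'cV[R]_d.
Notation round := (round R M K).
Notation history t := (t.-tuple round).
Variables (p : probability 'I_M.+1 R)
  (pi : forall t, R.-pker (history t * 'I_M.+1) ~> 'I_K.+1).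
Local Open Scope ereal_scope.
Local Notation N theta c a := (normal_prob (dot (A c a) theta) (1 : R)).
Local Notation law theta t := (history_law A theta p pi t).
Local Notation pulls := (pulls A p pi).
Local Notation snoc h c a y := (append_round (h, c, a, y)).
Variables (theta delta : 'cV[R]_d).

(* Otherwise unification tries to relate the laws under [theta] and
   [theta + delta] by unfolding them. *)
Local Opaque history_law.

(* Log-likelihood ratio of N(<x, theta + delta>, 1) to N(<x, theta>, 1). *)
Definition round_llr (z : round) : R :=
  - (dot (A z.1.1 z.1.2) delta ^+ 2 / 2) +
  dot (A z.1.1 z.1.2) delta * ((z.2 : R) - dot (A z.1.1 z.1.2) theta).

Definition llr t (h : history t) : R := \sum_(z <- h) round_llr z.

Lemma measurable_round_llr : measurable_fun setT round_llr.
Proof.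
apply: measurable_round => c a; rewrite /round_llr /=.
apply: measurable_funD => //; apply: measurable_funM => //.
exact: measurable_funB.
Qed.

Lemma measurable_llr t : measurable_fun setT (@llr t).
Proof. exact: measurable_history_sum measurable_round_llr. Qed.

Lemma measurable_exp_llr t :
  measurable_fun setT (fun h : history t => (expR (llr h))%:E).
Proof.
by apply/measurable_EFinP; apply: measurableT_comp => //; exact: measurable_llr.
Qed.

(** By induction on t. The weights of contexts and arms are the same under both parameters, so that
    only the Gaussian reward densities enter the ratio, and these multiply along the rounds. *)
Lemma ge0_integral_history_shift t (f : history t -> \bar R) :
    (forall h, 0 <= f h) -> measurable_fun setT f ->
  \int[law (theta + delta) t]_h f h =
  \int[law theta t]_h (f h * (expR (llr h))%:E).
Proof.
elim: t f => [|t IH] f f0 mf.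
  rewrite !history_law0; apply: eq_integral => h _.
  by rewrite tuple0 /llr big_nil expR0 mule1.
have e0 n (h : history n) : 0 <= (expR (llr h))%:E by rewrite lee_fin expR_ge0.
have mfe : measurable_fun setT (fun h => f h * (expR (llr h))%:E).
  by apply: emeasurable_funM => //; exact: measurable_exp_llr.
rewrite [LHS](ge0_integral_historyS A p pi (theta + delta) f0 mf).
rewrite [LHS](IH _ (fun h => step_ge0 _ _ _ _ _ f0)
  (measurable_step A p pi (theta + delta) f0 mf)).
have fe0 h : 0 <= f h * (expR (llr h))%:E by rewrite mule_ge0.
rewrite [RHS](ge0_integral_historyS A p pi theta fe0 mfe).
apply: eq_integral => h _; rewrite stepE// stepE//.
have i0 c a : 0 <= \int[N (theta + delta) c a]_y f (snoc h c a y).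
  exact: integral_ge0.
rewrite ge0_sume_distrl; last first.
  by move=> c _; apply: sume_ge0 => a _; rewrite !mule_ge0.
apply: eq_bigr => c _.
rewrite ge0_sume_distrl; last by move=> a _; rewrite !mule_ge0.
apply: eq_bigr => a _; rewrite -muleA; congr (_ * _).
have mfs : measurable_fun setT (fun y => f (snoc h c a y)).
  apply: (measurableT_comp mf); apply: (measurableT_comp (@measurable_append _ _ _ _)).
  exact: pair1_measurable.
rewrite dotDr ge0_integral_normal_shift// -ge0_integralZr//; last 2 first.
- apply: emeasurable_funM => //; apply/measurable_EFinP.
  apply: measurableT_comp => //; apply: measurable_funB => //.
  by apply: measurable_funM => //; exact: measurable_funB.
- by move=> y _; rewrite mule_ge0// lee_fin expR_ge0.
apply: eq_integral => y _; rewrite -muleA -EFinM -expRD; congr (_ * (expR _)%:E).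
by rewrite /llr /= big_cons /round_llr /= [X in (X + _)%R]addrC.
Qed.

(** Only the drifts of [round_llr] survive. Up to sign, the value is the Kullback-Leibler divergence
    of the two history laws. *)
Lemma integral_llr t :
  (law theta t).-integrable setT (fun h => (llr h)%:E) /\
  \int[law theta t]_h (llr h)%:E =
  (- \sum_c \sum_a pulls theta t c a * (dot (A c a) delta ^+ 2 / 2))%:E.
Proof.
rewrite -sumrN; under eq_bigr do rewrite -sumrN.
under eq_bigr do under eq_bigr do rewrite -mulrN.
apply: (@integral_history_sum _ _ _ _ A p pi theta t round_llr) => //.
- exact: measurable_round_llr.
- move=> c a; set x := dot (A c a) delta.
  exact: (integrable_normal_affine _ (- (x ^+ 2 / 2)) x).
- move=> c a; set x := dot (A c a) delta.
  exact: (integral_normal_affine _ (- (x ^+ 2 / 2)) x).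
Qed.

Lemma integral_exp_llr t : \int[law theta t]_h (expR (llr h))%:E = 1.
Proof.
have := @ge0_integral_history_shift t (cst 1) (fun=> lee01) (measurable_cst _).
rewrite [X in X = _ -> _]integral_probability_cst => ->.
by apply: eq_integral => h _; rewrite mul1e.
Qed.

Lemma integrable_exp_llr t :
  (law theta t).-integrable setT (fun h => (expR (llr h))%:E).
Proof.
apply/integrableP; split; first exact: measurable_exp_llr.
under eq_integral do rewrite gee0_abs ?lee_fin ?expR_ge0//.
by rewrite integral_exp_llr ltry.
Qed.

(* With v = e^(a/2) and w = e^(s/2), the left-hand side is at most
   v w - v^2 (1 + w^2) / 4, which is at most 1 and at most w^2. *)
Lemma likelihood_tangent (f a s : R) : (0 <= f <= 1)%R ->
  (expR a * (1 + (s - a) / 2 - (1 + expR s) / 4) <= f + (1 - f) * expR s)%R.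
Proof.
move=> /andP[f0 f1]; set v := expR (a / 2); set w := expR (s / 2).
have v0 : (0 < v)%R by exact: expR_gt0.
have w0 : (0 < w)%R by exact: expR_gt0.
have -> : expR a = (v ^+ 2)%R by rewrite /v -expRM_natl; congr expR; field.
have -> : expR s = (w ^+ 2)%R by rewrite /w -expRM_natl; congr expR; field.
have : (v * (1 + (s - a) / 2) <= w)%R.
  have -> : w = (v * expR ((s - a) / 2))%R by rewrite -expRD; congr expR; field.
  by rewrite ler_pM2l// expR_ge1Dx.
move=> vw; have h1 : (0 <= 1 - (v * w - v ^+ 2 * (1 + w ^+ 2) / 4))%R.
  have -> : (1 - (v * w - v ^+ 2 * (1 + w ^+ 2) / 4) =
    (1 - v * w / 2) ^+ 2 + (v / 2) ^+ 2)%R by field.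
  by rewrite addr_ge0 ?sqr_ge0.
have h2 : (0 <= w ^+ 2 - (v * w - v ^+ 2 * (1 + w ^+ 2) / 4))%R.
  have -> : (w ^+ 2 - (v * w - v ^+ 2 * (1 + w ^+ 2) / 4) =
    (w - v / 2) ^+ 2 + (v * w / 2) ^+ 2)%R by field.
  by rewrite addr_ge0 ?sqr_ge0.
apply: (@le_trans _ _ (v * w - v ^+ 2 * (1 + w ^+ 2) / 4)%R).
  suff : (v * (v * (1 + (s - a) / 2)) <= v * w)%R by lra.
  by rewrite ler_pM2l.
have := mulr_ge0 f0 h1; have f1' : (0 <= 1 - f)%R by lra.
have := mulr_ge0 f1' h2; lra.
Qed.

(* Le Cam's two-point bound, in the Bretagnolle-Huber form. *)
Lemma testing_bound t (f : history t -> R) :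
    (forall h, (0 <= f h <= 1)%R) -> measurable_fun setT f ->
  (expR (- \sum_c \sum_a pulls theta t c a * (dot (A c a) delta ^+ 2 / 2)) / 2)%:E <=
  \int[law theta t]_h (f h)%:E + \int[law (theta + delta) t]_h (1 - f h)%:E.
Proof.
move=> f01 mf; have [il El] := integral_llr t; set a := (- _)%R in El *.
have f0 h : (0 <= f h)%R by have /andP[] := f01 h.
have f1 h : (0 <= 1 - f h)%R by rewrite subr_ge0; have /andP[] := f01 h.
have mf' : measurable_fun setT (fun h => (f h)%:E) by exact/measurable_EFinP.
have m1f : measurable_fun setT (fun h => (1 - f h)%:E).
  by apply/measurable_EFinP; exact: measurable_funB.
have me := measurable_exp_llr (t := t).
have ie := integrable_exp_llr t.
have f1' h : 0 <= (1 - f h)%:E by rewrite lee_fin.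
rewrite [X in _ + X](ge0_integral_history_shift f1' m1f).
rewrite -ge0_integralD//; last 3 first.
- by move=> h _; rewrite lee_fin.
- by move=> h _; rewrite -EFinM lee_fin mulr_ge0 ?expR_ge0.
- exact: emeasurable_funM.
(* These are the coefficients of 1, s and e^s in the left-hand side of [likelihood_tangent]. With
   [a] the mean of [llr] and e^[llr] of mean 1, the integral is exactly e^a / 2. *)
pose c0 := (expR a * (3 / 4 - a / 2))%R; pose c1 := (expR a / 2)%R.
pose c2 := (- (expR a / 4))%R.
have i0 : (law theta t).-integrable setT (cst c0%:E).
  exact: finite_measure_integrable_cst.
have i1 : (law theta t).-integrable setT (fun h => c1%:E * (llr h)%:E).
  exact: integrableZl.
have i2 : (law theta t).-integrable setT (fun h => c2%:E * (expR (llr h))%:E).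
  exact: integrableZl.
have i01 := integrableD measurableT i0 i1.
have i012 := integrableD measurableT i01 i2.
apply: (@le_trans _ _ (\int[law theta t]_h
    (cst c0%:E h + c1%:E * (llr h)%:E + c2%:E * (expR (llr h))%:E))).
  rewrite integralD// integralD// !integralZl// integral_exp_llr El.
  rewrite (integral_probability_cst _ c0) mule1 -!EFinM -!EFinD lee_fin.
  suff -> : (c0 + c1 * a + c2 = expR a / 2)%R by [].
  by rewrite /c0 /c1 /c2; field.
apply: le_integral => //.
  (* The sum f + (1 - f) e^[llr] is dominated by 1 + e^[llr]. *)
  have i1e := integrableD measurableT
    (finite_measure_integrable_cst (law theta t) 1 measurableT) ie.
  apply: le_integrable i1e => //.
    by apply: emeasurable_funD => //; exact: emeasurable_funM.
  move=> h _; rewrite /= lee_fin.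
  have h1 := expR_gt0 (llr h); have h2 := f0 h; have h3 := f1 h.
  have h4 := mulr_ge0 h2 (ltW h1); have h5 := mulr_ge0 h3 (ltW h1).
  by rewrite !ger0_norm; nra.
move=> h _; rewrite /= -!EFinM -!EFinD lee_fin.
have := likelihood_tangent a (llr h) (f01 h); rewrite /c0 /c1 /c2; lra.
Qed.

End change_of_measure.

(** * Information that a consistent policy must gather *)

Section exploration.
Context (R : realType) (d M K : nat).
Variable A : 'I_M.+1 -> 'I_K.+1 -> 'cV[R]_d.
Notation history t := (t.-tuple (round R M K)).
Variable p : probability 'I_M.+1 R.
Implicit Types theta delta : 'cV[R]_d.

(* Kullback-Leibler divergence of the laws of n rounds under theta and under
   theta + delta. *)
Definition information (pi : forall t, R.-pker (history t * 'I_M.+1) ~> 'I_K.+1)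
    theta delta n : R :=
  \sum_c \sum_a pulls A p pi theta n c a * (dot (A c a) delta ^+ 2 / 2).

Section fixed_horizon.
Variable pi : forall t, R.-pker (history t * 'I_M.+1) ~> 'I_K.+1.
Local Open Scope ereal_scope.
Local Notation law theta t := (history_law A theta p pi t).
Local Notation play := (play A p pi).
Local Notation pulls := (pulls A p pi).

Lemma le_information theta delta i n : (i <= n)%N ->
  (information pi theta delta i <= information pi theta delta n)%R.
Proof.
move=> /subnKC <-; apply: ler_sum => c _; apply: ler_sum => a _.
apply: ler_wpM2r; first by rewrite mulr_ge0 ?sqr_ge0.
rewrite /pulls big_split_ord /= lerDl.
by apply: sumr_ge0 => j _; rewrite fine_ge0// play_ge0.
Qed.

Let q i m k (h : history i) : R := fine (pi i (h, m) [set k]).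

Let qE i m k h : pi i (h, m) [set k] = (@q i m k h)%:E.
Proof.
rewrite /q fineK// ge0_fin_numE//; apply: (@le_lt_trans _ _ 1); last exact: ltry.
by rewrite -(@prob_kernel _ _ _ _ _ (pi i) (h, m)); apply: le_measure; rewrite ?inE.
Qed.

Let q_ge0 i m k h : (0 <= @q i m k h)%R.
Proof. exact: fine_ge0. Qed.

Let sum_q i m h : (\sum_k @q i m k h = 1)%R.
Proof.
apply: EFin_inj; rewrite -sumEFin.
rewrite -(@prob_kernel _ _ _ _ _ (pi i) (h, m)).
transitivity (\int[pi i (h, m)]_k cst 1 k); last by rewrite integral_cst// mul1e.
by rewrite ge0_integral_ord//; apply: eq_bigr => k _; rewrite mule1 qE.
Qed.

Let measurable_q i m k : measurable_fun setT (@q i m k).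
Proof.
apply/measurable_EFinP; rewrite (_ : _ \o _ = (fun h => pi i (h, m) [set k])).
  exact: (measurableT_comp (measurable_kernel (pi i) [set k] _)).
by apply/funext => h; rewrite qE.
Qed.

Let playE theta i m k :
  play theta i m k = p [set m] * \int[law theta i]_h (@q i m k h)%:E.
Proof.
rewrite /play ge0_integralZl//; last first.
  exact: (measurableT_comp (measurable_kernel (pi i) [set k] _)).
by congr (_ * _); apply: eq_integral => h _; rewrite qE.
Qed.

(** In each round, [testing_bound] bounds from below the probability of avoiding k under [theta]
    plus that of playing k under [theta + delta], given context m. Multiplying by the probability of
    m and summing over the rounds yields plays. *)
Lemma exploration_bound theta delta n m k :
  (n%:R * (fine (p [set m]) * (expR (- information pi theta delta n) / 2)) <=
   \sum_(j | j != k) pulls theta n m j + pulls (theta + delta) n m k)%R.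
Proof.
set x := (_ * (_ / 2))%R.
have -> : (n%:R * x = \sum_(i < n) x)%R by rewrite sumr_const card_ord mulr_natl.
rewrite /pulls exchange_big/= -big_split/=; apply: ler_sum => i _; rewrite {}/x.
have pm : p [set m] = (fine (p [set m]))%:E.
  by rewrite fineK//; exact: fin_num_measure.
pose I th j := \int[law th i]_h (@q i m j h)%:E.
have fplay th j : (fine (play th i m j))%:E = p [set m] * I th j.
  by rewrite (fineK (play_fin_num A p pi th i m j)) playE.
have I0 th j : 0 <= I th j by apply: integral_ge0 => h _; rewrite lee_fin.
rewrite -lee_fin [leRHS]EFinD -sumEFin.
rewrite (eq_bigr _ (fun j _ => fplay theta j)) fplay.
rewrite -[X in _ <= X + _]ge0_sume_distrr//.
rewrite -[leRHS]ge0_muleDr//; last by apply: sume_ge0 => j _; exact: I0.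
rewrite EFinM -pm; apply: lee_wpmul2l => //.
(* Information only grows with time, so the bound for round i is weakened to one uniform in i. *)
apply: (@le_trans _ _ (expR (- information pi theta delta i) / 2)%:E).
  by rewrite lee_fin ler_pM2r// ler_expR lerN2 le_information// ltnW.
have f01 h : (0 <= 1 - @q i m k h <= 1)%R.
  rewrite subr_ge0 lerBlDr lerDl q_ge0 andbT -(sum_q m h) (bigD1 k)//= lerDl.
  by apply: sumr_ge0 => j _; exact: q_ge0.
have mf : measurable_fun setT (fun h => 1 - @q i m k h)%R.
  by apply: measurable_funB => //; exact: measurable_q.
apply: le_trans (testing_bound A p pi theta delta f01 mf) _.
rewrite leeD//; last first.
  rewrite le_eqVlt; apply/orP; left; apply/eqP.
  by apply: eq_integral => h _; congr EFin; ring.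
rewrite -[leRHS]big_filter -ge0_integral_sum//; last 2 first.
- by move=> j; apply/measurable_EFinP; exact: measurable_q.
- by move=> j h _; rewrite lee_fin.
rewrite le_eqVlt; apply/orP; left; apply/eqP; apply: eq_integral => h _.
rewrite big_filter sumEFin; congr EFin.
by rewrite -[X in (X - _)%R](sum_q m h) (bigD1 k)//= addrAC subrr add0r.
Qed.

End fixed_horizon.

Lemma regret_ge_pull theta (pi : policy R M K) n m k :
  ((pulls A p (pi n) theta n m k * gap A theta m k)%:E <= regret A theta p pi n)%E.
Proof.
rewrite regretE lee_fin (bigD1 m)//= (bigD1 k)//= -addrA lerDl.
by apply: addr_ge0; apply: sumr_ge0 => *; [|apply: sumr_ge0 => *];
  rewrite mulr_ge0 ?pulls_ge0 ?gap_ge0.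
Qed.

(** Each play of a suboptimal arm costs its gap, so consistency under both parameters bounds the
    right-hand side of [exploration_bound] by n^eps [B]. Taking logarithms of n [c] e^(-I) <= n^eps
    gives the claim with C = - ln [c]. *)
Lemma information_lower_bound theta delta (pi : policy R M K) m k :
    consistent A pi -> (0 < p [set m])%E ->
    (forall j, j != k -> 0 < gap A theta m j) ->
    0 < gap A (theta + delta) m k ->
  forall eps : R, 0 < eps -> exists C : R, \forall n \near \oo,
    (1 - eps) * ln n%:R - C <= information (pi n) theta delta n.
Proof.
move=> cpi pm gapj gapk eps eps0.
pose B := \sum_(j | j != k) (gap A theta m j)^-1 + (gap A (theta + delta) m k)^-1.
have B0 : 0 < B.
  rewrite ltr_wpDl ?invr_gt0// sumr_ge0// => j _.
  by rewrite invr_ge0 gap_ge0.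
have pm0 : 0 < fine (p [set m]).
  by rewrite fine_gt0// pm/= ltey_eq fin_num_measure.
pose c := fine (p [set m]) / (2 * B).
have c0 : 0 < c by rewrite divr_gt0// mulr_gt0.
exists (- ln c).
have r1 := cpi p theta eps eps0 1 ltr01.
have r2 := cpi p (theta + delta) eps eps0 1 ltr01.
have pull_le th n j : 0 < gap A th m j ->
    (`|regret A th p pi n| <= (1 * n%:R `^ eps)%:E)%E ->
    pulls A p (pi n) th n m j <= n%:R `^ eps * (gap A th m j)^-1.
  move=> g0 rn; rewrite ler_pdivlMr// -lee_fin -[X in (_ <= X%:E)%E]mul1r.
  apply: le_trans rn; apply: le_trans (regret_ge_pull _ _ _ _ _) _.
  exact: lee_abs.
near=> n.
have n0 : 0 < n%:R :> R by rewrite ltr0n; near: n; exact: nbhs_infty_gt.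
set I := information _ _ _ _.
have : n%:R * (fine (p [set m]) * (expR (- I) / 2)) <= n%:R `^ eps * B.
  apply: le_trans (exploration_bound (pi n) theta delta n m k) _.
  rewrite /B mulrDr mulr_sumr lerD//.
    apply: ler_sum => j jk; apply: pull_le; first exact: gapj.
    by near: n.
  by apply: pull_le => //; near: n.
have -> : n%:R * (fine (p [set m]) * (expR (- I) / 2)) = n%:R * c * expR (- I) * B.
  by rewrite /c; field; rewrite gt_eqF.
rewrite ler_pM2r// => le_c.
suff : expR (ln n%:R + ln c - I) <= expR (eps * ln n%:R) by rewrite ler_expR; lra.
by rewrite !expRD !lnK ?posrE//; move: le_c; rewrite /powR gt_eqF.
Unshelve. all: by end_near. Qed.

End exploration.

(** * Designs with infinite weights *)

Section ultrafilter_limits.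
Context (R : realType) (T : Type) (G : set_system T).
Hypothesis GU : UltraFilter G.

(** The image filter clusters in the compact segment [-b, b], and an ultrafilter converges to its
    cluster points. *)
Lemma ultra_bounded_cvg (f : T -> R) (b : R) :
  G [set t | `|f t| <= b] -> exists l : R, f t @[t --> G] --> l.
Proof.
move=> Gb; have GP : ProperFilter G := @ultra_proper _ _ GU.
have fGP : ProperFilter (f @ G) by exact: fmap_proper_filter.
have [|l [_ lcl]] := @segment_compact R (- b) b (f @ G) fGP.
  apply: (@filterS _ G _ _ _ _ Gb) => t /= tb.
  by rewrite in_itv/= -ler_norml.
exists l => V /= lV; have [//|GVC] := in_ultra_setVsetC (f @^-1` V) GU.
by have [y [/= nVy Vy]] := lcl (~` V) V GVC lV.
Qed.

End ultrafilter_limits.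

Lemma cvg_sumr (R : realType) (T : Type) (F : set_system T) (I : finType)
    (P : pred I) (f : I -> T -> R) (l : I -> R) : Filter F ->
  (forall i, P i -> f i t @[t --> F] --> l i) ->
  \sum_(i | P i) f i t @[t --> F] --> \sum_(i | P i) l i.
Proof. by move=> FF fl; apply: cvg_big => //; exact: add_continuous. Qed.

Section design.
Context (R : realType) (d M K : nat).
Variable A : 'I_M.+1 -> 'I_K.+1 -> 'cV[R]_d.
Implicit Types (w : 'I_M.+1 -> 'I_K.+1 -> R) (u v x : 'cV[R]_d).

Definition design w : 'M[R]_d := \sum_m \sum_k w m k *: (A m k *m (A m k)^T).

(** The bilinear form of the matrix [design w], written as a sum so that comparisons and limits in
    the weights or vectors go term by term. *)
Definition dform w u v : R := \sum_m \sum_k w m k * (dot (A m k) u * dot (A m k) v).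

Lemma dotC u v : dot u v = dot v u.
Proof. by rewrite /dot !mxE; apply: eq_bigr => i _; rewrite !mxE mulrC. Qed.

Lemma dot_sum u v : dot u v = \sum_i u i 0 * v i 0.
Proof. by rewrite /dot mxE; apply: eq_bigr => i _; rewrite mxE. Qed.

Lemma dot_design w u v : dot u (design w *m v) = dform w u v.
Proof.
rewrite /dot /design mulmx_suml mulmx_sumr summxE; apply: eq_bigr => m _.
rewrite mulmx_suml mulmx_sumr summxE; apply: eq_bigr => k _.
rewrite -scalemxAl -scalemxAr mxE; congr (_ * _).
rewrite -mulmxA [u^T *m (_ *m _)]mulmxA.
have -> : (u^T *m A m k) = ((A m k)^T *m u)^T by rewrite trmx_mul trmxK.
by rewrite !mxE big_ord1 mxE.
Qed.

Lemma dform_ge0 w u : (forall m k, 0 <= w m k) -> 0 <= dform w u u.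
Proof.
move=> w0; apply: sumr_ge0 => m _; apply: sumr_ge0 => k _.
by rewrite mulr_ge0// -expr2 sqr_ge0.
Qed.

Lemma le_dform w w' u : (forall m k, w m k <= w' m k) ->
  dform w u u <= dform w' u u.
Proof.
move=> ww'; apply: ler_sum => m _; apply: ler_sum => k _.
by rewrite ler_wpM2r// -expr2 sqr_ge0.
Qed.

Lemma dform_subZ w u v t : dform w (u - t *: v) (u - t *: v) =
  dform w u u - 2 * t * dform w u v + t ^+ 2 * dform w v v.
Proof.
rewrite /dform !mulr_sumr -sumrB -big_split/=; apply: eq_bigr => m _.
rewrite !mulr_sumr -sumrB -big_split/=; apply: eq_bigr => k _.
have -> : dot (A m k) (u - t *: v) = dot (A m k) u - t * dot (A m k) v.
  by rewrite dotDr -scaleNr dotZr mulNr.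
by ring.
Qed.

(** The quadratic polynomial t -> form of u - t v is nonnegative. *)
Lemma dform_CS w u v : (forall m k, 0 <= w m k) ->
  dform w u v ^+ 2 <= dform w u u * dform w v v.
Proof.
move=> w0; set a := dform w u u; set b := dform w u v; set c := dform w v v.
have a0 : 0 <= a by exact: dform_ge0.
have c0 : 0 <= c by exact: dform_ge0.
have key t : 0 <= a - 2 * t * b + t ^+ 2 * c by rewrite -dform_subZ dform_ge0.
have [c_eq0|cn0] := eqVneq c 0.
  have [->|bn0] := eqVneq b 0; first by rewrite expr0n/= mulr_ge0.
  (* When c = 0 the polynomial is affine in t, and here it takes the value -1. *)
  have := key ((a + 1) / (2 * b)); rewrite c_eq0 mulr0 addr0.
  have -> : 2 * ((a + 1) / (2 * b)) * b = a + 1 by field.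
  lra.
have cp : 0 < c by rewrite lt_neqAle eq_sym cn0.
have := key (b / c).
have -> : a - 2 * (b / c) * b + (b / c) ^+ 2 * c = a - b ^+ 2 / c by field.
by rewrite subr_ge0 ler_pdivrMr.
Qed.

Hypothesis A_span : forall m, (<<codom (A m)>> = fullv)%VS.

Lemma span_dot_eq0 m u : (forall k, dot (A m k) u = 0) -> u = 0.
Proof.
move=> Au; have : u \in (<<codom_tuple (A m)>>)%VS by rewrite A_span memvf.
move=> /coord_span uE; have uu : dot u u = 0.
  rewrite {1}uE /dot linear_sum mulmx_suml summxE big1// => i _.
  have /codomP[k ->] : (codom_tuple (A m))`_i \in codom (A m).
    by apply: mem_nth; rewrite size_tuple.
  by rewrite linearZ/= -scalemxAl mxE -/(dot _ _) Au mulr0.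
move: uu; rewrite dot_sum => /eqP; rewrite psumr_eq0; last first.
  by move=> i _; rewrite -expr2 sqr_ge0.
move=> /allP u0; apply/matrixP => i j; rewrite ord1 mxE.
by have := u0 i (mem_index_enum i); rewrite mulf_eq0 orbb => /eqP.
Qed.

(** A vector in the kernel has form zero, hence, the weights being positive, is orthogonal to all
    arms of one context, which span the space. *)
Lemma design_unit w : (forall m k, 0 < w m k) -> design w \in unitmx.
Proof.
move=> w0; rewrite -row_free_unit; apply: inj_row_free => v vw.
suff : v^T = 0 by move=> /(congr1 trmx); rewrite trmxK trmx0.
have : dform w v^T v^T = 0.
  by rewrite -dot_design /dot trmxK mulmxA vw mul0mx mxE.
have t0 m k : 0 <= w m k * (dot (A m k) v^T * dot (A m k) v^T).
  by rewrite mulr_ge0 ?(ltW (w0 _ _))// -expr2 sqr_ge0.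
move=> /eqP; rewrite psumr_eq0; last by move=> m _; exact: sumr_ge0.
move=> /allP /(_ ord0 (mem_index_enum _)); rewrite psumr_eq0//.
move=> /allP v0; apply: (@span_dot_eq0 ord0) => k.
have := v0 k (mem_index_enum k); rewrite mulf_eq0 gt_eqF//= mulf_eq0 orbb.
by move=> /eqP.
Qed.

Definition inv_form w x : R := (x^T *m invmx (design w) *m x) 0 0.

Section positive_weights.
Variable w : 'I_M.+1 -> 'I_K.+1 -> R.
Hypothesis w0 : forall m k, 0 < w m k.

Let wge0 m k : 0 <= w m k. Proof. exact: ltW. Qed.

Lemma dform_invmx x u : dform w u (invmx (design w) *m x) = dot x u.
Proof. by rewrite -dot_design mulKVmx ?design_unit// dotC. Qed.

Lemma inv_formE x :
  inv_form w x = dform w (invmx (design w) *m x) (invmx (design w) *m x).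
Proof. by rewrite dform_invmx /inv_form -mulmxA. Qed.

Lemma inv_form_ge0 x : 0 <= inv_form w x.
Proof. by rewrite inv_formE dform_ge0. Qed.

(** Cauchy-Schwarz against H^-1 x, which represents the functional <x, .> for the form of H. *)
Lemma dot_sqr_le x u : dot x u ^+ 2 <= inv_form w x * dform w u u.
Proof. by rewrite -dform_invmx inv_formE mulrC; exact: dform_CS. Qed.

End positive_weights.

(** Testing [dot_sqr_le] for [w] at u = H'^-1 x gives q'^2 <= q q', where q and q' are the two
    inverse forms; then q' is cancelled unless it vanishes. *)
Lemma le_inv_form w w' x : (forall m k, 0 < w m k) ->
  (forall m k, w m k <= w' m k) -> inv_form w' x <= inv_form w x.
Proof.
move=> w0 ww'; have w'0 m k : 0 < w' m k by exact: lt_le_trans (ww' m k).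
have := dot_sqr_le w0 x (invmx (design w') *m x).
rewrite -(dform_invmx w'0) -(inv_formE w'0) => h.
have {h} : inv_form w' x ^+ 2 <= inv_form w x * inv_form w' x.
  apply: le_trans h _; rewrite ler_wpM2l ?inv_form_ge0//.
  by rewrite (inv_formE w'0) le_dform.
have := inv_form_ge0 w'0 x; rewrite le_eqVlt => /orP[/eqP <- _|q0].
  exact: inv_form_ge0.
by rewrite expr2 ler_pM2r.
Qed.

Section truncation.
Variable alpha : 'I_M.+1 -> 'I_K.+1 -> \bar R.
Hypothesis alpha0 : forall m k, (0 < alpha m k)%E.

(** Chosen so that [trunc_design A alpha L] is by definition [design] of these weights. *)
Definition trunc_weight (L : R) m k : R := fine (Order.min (alpha m k) L%:E).

Lemma trunc_weightE L m k : (trunc_weight L m k)%:E = Order.min (alpha m k) L%:E.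
Proof.
rewrite /trunc_weight fineK// fin_numElt; apply/andP; split.
  by rewrite lt_min ltNyr (lt_trans _ (alpha0 m k)).
by rewrite gt_min ltry orbT.
Qed.

Lemma trunc_weight_gt0 L m k : 0 < L -> 0 < trunc_weight L m k.
Proof. by move=> L0; rewrite -lte_fin trunc_weightE lt_min alpha0 lte_fin. Qed.

Lemma le_trunc_weight L L' m k : L <= L' -> trunc_weight L m k <= trunc_weight L' m k.
Proof.
move=> LL'; rewrite -lee_fin !trunc_weightE le_min !ge_min lexx/=.
by rewrite lee_fin LL' orbT.
Qed.

(** A bound [b] valid for all truncations stands for a bound on u^T H u with infinite weights
    allowed. If the limit l of x^T H_L^-1 x exceeded c, a limit point u of the minimisers would have
    form at most 1 / l at every truncation, and the hypothesis would give l <= c. *)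
Lemma inv_form_le_of_dform x c : 0 <= c ->
    (forall u b, dot x u = 1 ->
      (forall L, 0 < L -> dform (trunc_weight L) u u <= b) -> 1 <= c * b) ->
  inv_form_le A alpha x c.
Proof.
move=> c0 H; have w0 L : 0 < L -> forall m k, 0 < trunc_weight L m k.
  by move=> L0 m k; exact: trunc_weight_gt0.
split.
  near=> L; apply: design_unit => m k; apply: trunc_weight_gt0; near: L.
  exact: nbhs_pinfty_gt.
pose f L := inv_form (trunc_weight L) x.
rewrite -[X in lim X]/(f @ +oo).
have f_ge0 L : 0 < L -> 0 <= f L by move=> L0; apply: inv_form_ge0; exact: w0.
have f_ni L L' : 0 < L -> L <= L' -> f L' <= f L.
  move=> L0 LL'; apply: le_inv_form; first exact: w0.
  by move=> m k; exact: le_trunc_weight.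
(* The convergence theorem asks for a function nondecreasing on the whole line; the maximum avoids
   the nonpositive levels, where the design may be singular. *)
pose g L := - f (Num.max L 1).
have max0 (L : R) : 0 < Num.max L 1 by rewrite lt_max ltr01 orbT.
have g_nd : {homo g : a b / a <= b}.
  move=> a b ab; rewrite lerN2 f_ni// ge_max !le_max.
  by rewrite ab lexx orbT.
have g_ub : has_ubound (range g).
  by exists 0 => _ [L _ <-]; rewrite oppr_le0 f_ge0.
have g_cvg := nondecreasing_cvgr g_nd g_ub.
set s := sup _ in g_cvg.
have f_cvg : f L @[L --> +oo] --> - s.
  apply: cvg_trans (cvgN g_cvg); apply: near_eq_cvg; near=> L.
  rewrite /g /= opprK; congr f; apply/max_idPl; near: L.
  exact: nbhs_pinfty_ge.
rewrite (cvg_lim _ f_cvg)//; set l := - s in f_cvg *.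
have l_le L : 0 < L -> l <= f L.
  move=> L0; rewrite -(cvg_lim _ f_cvg)//.
  apply: limr_le; first by apply/cvg_ex; eexists; exact: f_cvg.
  by near=> L'; apply: f_ni => //; near: L'; exact: nbhs_pinfty_ge.
rewrite leNgt; apply/negP => cl; have l0 : 0 < l by exact: le_lt_trans cl.
have fL0 L : 0 < L -> 0 < f L by move=> L0; apply: lt_le_trans (l_le _ L0).
pose a L := invmx (design (trunc_weight L)) *m x.
(* The minimiser of the truncated form over <x, u> = 1, with minimum 1 / [f L]. *)
pose U L := (f L)^-1 *: a L.
have xa L : 0 < L -> dot x (a L) = f L.
  by move=> L0; rewrite -(dform_invmx (w0 _ L0)) -inv_formE//; exact: w0.
have xU L : 0 < L -> dot x (U L) = 1.
  by move=> L0; rewrite dotZr xa// mulVf// gt_eqF// fL0.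
have UU L : 0 < L -> dform (trunc_weight L) (U L) (U L) <= l^-1.
  move=> L0; have -> : dform (trunc_weight L) (U L) (U L) = (f L)^-1.
    rewrite -dot_design -scalemxAr dotZr mulKVmx ?design_unit//; last exact: w0.
    by rewrite dotC xU// mulr1.
  by rewrite lef_pV2 ?posrE ?fL0// l_le.
have [G [GU Goo]] := @ultraFilterLemma R +oo _.
have GP : ProperFilter G := @ultra_proper _ _ GU.
have Uconv i : exists v : R, U L i 0 @[L --> G] --> v.
  pose e : 'cV[R]_d := delta_mx i 0.
  (* The coordinate is <e_i, U>, so its square is at most the inverse form at level 1 times 1 / l;
     the bound 1 + B then follows from z^2 <= B. *)
  apply: (@ultra_bounded_cvg _ _ _ GU _ (1 + inv_form (trunc_weight 1) e * l^-1)).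
  apply: Goo; near=> L.
  have L1 : 1 <= L by near: L; exact: nbhs_pinfty_ge.
  have h := dot_sqr_le (w0 _ ltr01) e (U L).
  have eU : dot e (U L) = U L i 0.
    rewrite dot_sum (bigD1 i)//= big1 ?addr0 ?mxE ?eqxx ?mul1r//.
    by move=> j ji; rewrite mxE (negbTE ji) mul0r.
  have h2 : inv_form (trunc_weight 1) e * dform (trunc_weight 1) (U L) (U L) <=
      inv_form (trunc_weight 1) e * l^-1.
    rewrite ler_wpM2l ?(inv_form_ge0 (w0 _ ltr01))//.
    apply: le_trans (UU L (lt_le_trans ltr01 L1)); apply: le_dform => m k.
    exact: le_trunc_weight.
  rewrite eU -real_normK ?num_real// in h.
  move: (le_trans h h2); rewrite /=; set z := `|_|; set B := _ / l => zB.
  have := sqr_ge0 z; have := sqr_ge0 (z - 1); rewrite sqrrB1; lra.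
have [v vP] := choice Uconv.
pose u : 'cV[R]_d := \col_i v i.
have dot_cvg y : dot y (U L) @[L --> G] --> dot y u.
  rewrite dot_sum; under eq_fun do rewrite dot_sum.
  apply: cvg_sumr => i _; rewrite mxE; apply: cvgM; first exact: cvg_cst.
  exact: vP.
have xu : dot x u = 1.
  have h1 : dot x (U L) @[L --> G] --> (1 : R).
    apply: cvg_near_cst; apply: Goo; near=> L; apply: xU; near: L.
    exact: nbhs_pinfty_gt.
  exact: cvg_unique (dot_cvg x) h1.
have := H u l^-1 xu _.
suff h L : 0 < L -> dform (trunc_weight L) u u <= l^-1.
  by move=> /(_ h); rewrite ler_pdivlMr// mul1r leNgt cl.
(* With L fixed and L' >= L, the form at level L of [U L'] is at most the one at level L', hence at
   most 1 / l; then L' tends to infinity along [G]. *)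
move=> L0; have dc : dform (trunc_weight L) (U L') (U L') @[L' --> G] -->
    dform (trunc_weight L) u u.
  apply: cvg_sumr => m _; apply: cvg_sumr => k _.
  by apply: cvgM; [exact: cvg_cst|apply: cvgM; exact: dot_cvg].
rewrite -(cvg_lim _ dc)//; apply: limr_le; first by apply/cvg_ex; eexists; exact: dc.
apply: Goo; near=> L'.
have LL' : L <= L' by near: L'; exact: (nbhs_pinfty_ge (num_real (L : R))).
apply: le_trans (UU L' (lt_le_trans L0 LL')); apply: le_dform => m k.
exact: le_trunc_weight.
Unshelve. all: by end_near. Qed.

End truncation.
End design.

Lemma limn_einf_lt_frequently (R : realType) (u : (\bar R)^nat) (c : \bar R) :
  (limn_einf u < c)%E -> forall n, exists2 k, (n <= k)%N & (u k < c)%E.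
Proof.
move=> uc n; have : (einfs u n < c)%E.
  apply: le_lt_trans uc; rewrite limn_einf_lim.
  rewrite (cvg_lim _ (ereal_nondecreasing_cvgn (nondecreasing_einfs u)))//.
  by apply: ereal_sup_ubound; exists n.
by move=> /ereal_inf_ltP[_ [k /= nk <-] ukc]; exists k.
Qed.

(** * From weights on the suboptimal arms to feasible allocations *)

Section relaxation.
Context (R : realType) (d M K : nat).
Variables (A : 'I_M.+1 -> 'I_K.+1 -> 'cV[R]_d) (theta : 'cV[R]_d).
Hypothesis A_span : forall m, (<<codom (A m)>> = fullv)%VS.
Variable alpha : 'I_M.+1 -> 'I_K.+1 -> R.
Hypothesis alpha0 : forall m k, 0 <= alpha m k.
Hypothesis alphaP : forall m k u, 0 < gap A theta m k -> dot (A m k) u = 1 ->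
  (forall m' k', gap A theta m' k' = 0 -> dot (A m' k') u = 0) ->
  1 <= gap A theta m k ^+ 2 / 2 * dform A alpha u u.

(* Infinite weights on the optimal arms are free of cost; the increment [e] makes
   all weights positive, hence the truncated designs invertible. *)
Definition relax (e : R) m k : \bar R :=
  if gap A theta m k == 0 then +oo%E else (alpha m k + e)%:E.

Lemma relax_gt0 e m k : 0 < e -> (0 < relax e m k)%E.
Proof.
move=> e0; rewrite /relax; case: ifP => // _.
by rewrite lte_fin ltr_wpDl.
Qed.

Lemma feasible_relax e : 0 < e -> feasible A theta (relax e).
Proof.
move=> e0; have r0 m k := relax_gt0 m k e0.
split => [m k|m k gap0]; first exact: ltW.
apply: inv_form_le_of_dform => //; first by rewrite mulr_ge0 ?sqr_ge0.
move=> u b xu ub.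
have w0 L m' k' : 0 < L -> 0 <= trunc_weight (relax e) L m' k'.
  by move=> L0; rewrite ltW// trunc_weight_gt0.
have optu m' k' : gap A theta m' k' = 0 -> dot (A m' k') u = 0.
  move=> gap_eq0; apply/eqP; apply: contraT => un0.
  pose z := dot (A m' k') u * dot (A m' k') u.
  have z0 : 0 < z by rewrite /z -expr2 exprn_even_gt0.
  (* At this level the term of the optimal arm alone is |b| + 1, which exceeds the bound [b]. *)
  have L0 : 0 < (`|b| + 1) / z by rewrite divr_gt0// ltr_wpDl.
  have := ub _ L0; rewrite leNgt => /negP; case.
  apply: (@lt_le_trans _ _ ((`|b| + 1) / z * z)).
    rewrite divfK ?gt_eqF//; have := ler_norm b; lra.
  rewrite /dform (bigD1 m')//= (bigD1 k')//= -addrA.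
  have -> : trunc_weight (relax e) ((`|b| + 1) / z) m' k' = (`|b| + 1) / z.
    by rewrite /trunc_weight /relax gap_eq0 eqxx min_r ?leey.
  rewrite lerDl addr_ge0// sumr_ge0// => i _; [|rewrite sumr_ge0// => j _];
    by rewrite mulr_ge0 ?w0// -expr2 sqr_ge0.
apply: le_trans (alphaP gap0 xu optu) _.
rewrite ler_wpM2l//; first by rewrite mulr_ge0 ?sqr_ge0.
(* This level exceeds every finite weight, so that truncation leaves the suboptimal arms
   unchanged. *)
pose L := \sum_m \sum_k (alpha m k + e) + 1.
have a0 m' k' : 0 <= alpha m' k' + e by rewrite addr_ge0// ltW.
have L0 : 0 < L.
  by rewrite ltr_wpDl// sumr_ge0// => i _; rewrite sumr_ge0.
apply: le_trans (ub L L0).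
apply: ler_sum => m' _; apply: ler_sum => k' _.
have [g0|gn0] := eqVneq (gap A theta m' k') 0; first by rewrite optu// !mulr0.
rewrite ler_wpM2r//; first by rewrite -expr2 sqr_ge0.
rewrite /trunc_weight /relax (negbTE gn0) min_l; first by rewrite /= lerDl ltW.
rewrite lee_fin /L (bigD1 m')//= (bigD1 k')//= -2!addrA lerDl.
rewrite addr_ge0 ?addr_ge0// sumr_ge0// => i _; rewrite sumr_ge0//.
Qed.

(** The feasible weights [relax e] cost at most [e] times the sum [S] of the gaps more than [alpha];
    scaling by [S + 1] also covers [S = 0]. *)
Lemma complexity_le_cost :
  (complexity A theta <= (\sum_m \sum_k alpha m k * gap A theta m k)%:E)%E.
Proof.
apply/lee_addgt0Pr => e e0.
pose S := \sum_m \sum_k gap A theta m k.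
have S0 : 0 <= S by apply: sumr_ge0 => m _; apply: sumr_ge0 => k _; exact: gap_ge0.
have e'0 : 0 < e / (S + 1) by rewrite divr_gt0// ltr_wpDl.
apply: le_trans (ereal_inf_lbound _) _.
  by exists (relax (e / (S + 1))); [exact: feasible_relax|reflexivity].
rewrite -EFinD; apply: (@le_trans _ _
  (\sum_m \sum_k (alpha m k + e / (S + 1)) * gap A theta m k)%:E).
  rewrite le_eqVlt; apply/orP; left; apply/eqP.
  rewrite -sumEFin; apply: eq_bigr => m _; rewrite -sumEFin; apply: eq_bigr => k _.
  rewrite /relax; case: eqP => [->|_]; last by rewrite EFinM.
  by rewrite mulr0 mule0.
rewrite lee_fin.
have -> : \sum_m \sum_k (alpha m k + e / (S + 1)) * gap A theta m k =
    \sum_m \sum_k alpha m k * gap A theta m k + e / (S + 1) * S.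
  rewrite /S mulr_sumr -big_split/=; apply: eq_bigr => m _.
  by rewrite mulr_sumr -big_split/=; apply: eq_bigr => k _; rewrite mulrDl.
rewrite lerD2l mulrAC ler_pdivrMr ?ltr_wpDl//.
by rewrite mulrDr mulr1 lerDl ltW.
Qed.

End relaxation.

(** * Limits of the normalised numbers of plays *)

Section asymptotics.
Context (R : realType) (d M K : nat).
Variables (A : 'I_M.+1 -> 'I_K.+1 -> 'cV[R]_d) (theta : 'cV[R]_d).
Hypothesis A_span : forall m, (<<codom (A m)>> = fullv)%VS.
Variable p : probability 'I_M.+1 R.
Hypothesis p_gt0 : forall m : 'I_M.+1, (0 < p [set m])%E.
Hypothesis unique_best : forall m,
  exists! k, forall j, dot (A m j) theta <= dot (A m k) theta.
Variable pi : policy R M K.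
Hypothesis pi_consistent : consistent A pi.

Let rate n m k : R := pulls A p (pi n) theta n m k / ln n%:R.

Lemma unique_best_gap m : exists2 k, gap A theta m k = 0 &
  forall j, j != k -> 0 < gap A theta m j.
Proof.
have [k [kmax kuniq]] := unique_best m.
have bestE : best A theta m = dot (A m k) theta by exact: sup_range_max.
exists k; first by rewrite gapE bestE subrr.
move=> j jk; rewrite gapE subr_gt0 lt_neqAle dot_le_best andbT.
apply: contra jk => /eqP jbest; apply/eqP/esym/kuniq => i.
by rewrite jbest dot_le_best.
Qed.

Lemma rate_lower_bound m k u (s : R) : gap A theta m k < s ->
    dot (A m k) u = 1 ->
    (forall m' k', gap A theta m' k' = 0 -> dot (A m' k') u = 0) ->
  forall e, 0 < e ->
  \forall n \near \oo, 1 - e <= s ^+ 2 / 2 * dform A (rate n) u u.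
Proof.
move=> gs xu optu e e0; have [k' k'0 k'gap] := unique_best_gap m.
(* The shift leaves the value of the optimal arm [k'] unchanged and raises that of [k] by s, which
   is more than its gap. *)
have gap' : 0 < gap A (theta + s *: u) m k'.
  have := dot_le_best A (theta + s *: u) m k.
  rewrite gapE dotDr dotZr xu mulr1 dotDr dotZr (optu _ _ k'0) mulr0 addr0.
  have := gapE A theta m k; have := gapE A theta m k'; rewrite k'0.
  lra.
(* One half of [e] pays for the exponent in the regret bounds, the other absorbs the constant [C]
   once ln n is large. *)
have e20 : 0 < e / 2 by rewrite divr_gt0.
have [C infoC] := information_lower_bound pi_consistent (p_gt0 m) k'gap gap' e20.
near=> n.
have n1 : 1 < n%:R :> R by rewrite ltr1n; near: n; exact: nbhs_infty_gt.
have ln0 : 0 < ln (n%:R : R) by rewrite ln_gt0.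
have Cln : C <= e / 2 * ln n%:R.
  rewrite -ler_pdivrMl// -ler_expR lnK ?posrE ?(lt_trans ltr01)//.
  by near: n; exact: nbhs_infty_ger.
have infoE : information A p (pi n) theta (s *: u) n =
    s ^+ 2 / 2 * dform A (rate n) u u * ln n%:R.
  rewrite /information /dform mulr_sumr mulr_suml; apply: eq_bigr => i _.
  rewrite mulr_sumr mulr_suml; apply: eq_bigr => j _.
  by rewrite dotZr /rate; field; rewrite gt_eqF.
rewrite -(ler_pM2r ln0) -infoE.
have : (1 - e / 2) * ln n%:R - C <= information A p (pi n) theta (s *: u) n.
  by near: n.
apply: le_trans; lra.
Unshelve. all: by end_near. Qed.

Lemma complexity_le_of_frequently (c : R) :
    (forall n, exists2 k, (n <= k)%N &
      (regret A theta p pi k * ((ln k%:R)^-1)%:E < c%:E)%E) ->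
  (complexity A theta <= c%:E)%E.
Proof.
move=> freq.
pose S : set nat := [set n | (regret A theta p pi n * ((ln n%:R)^-1)%:E < c%:E)%E].
have rateE n : (regret A theta p pi n * ((ln n%:R)^-1)%:E)%E =
    (\sum_m \sum_k rate n m k * gap A theta m k)%:E.
  rewrite regretE -EFinM; congr EFin; rewrite mulr_suml; apply: eq_bigr => m _.
  by rewrite mulr_suml; apply: eq_bigr => k _; rewrite /rate mulrAC.
have ln_ge0' n : 0 <= ln (n%:R : R).
  by case: n => [|n]; [rewrite ln0|rewrite ln_ge0// ler1n].
have rate_ge0 n m k : 0 <= rate n m k by rewrite divr_ge0 ?pulls_ge0.
(* [S] meets every tail, so an ultrafilter contains it together with all tails. *)
have FP : ProperFilter (within S \oo).
  apply: Build_ProperFilter => -[N _ NS].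
  by have [k Nk kS] := freq N; exact: NS k Nk kS.
have [G [GU WG]] := ultraFilterLemma FP.
have GP : ProperFilter G := @ultra_proper _ _ GU.
have Goo (P : set nat) : (\forall n \near \oo, P n) -> G P.
  by move=> nP; apply: WG; apply: filterS nP.
have GS : G S by apply: WG; exact: (nearW (F := \oo) (P := fun n => S n -> S n)).
have ratelt n : S n -> \sum_m \sum_k rate n m k * gap A theta m k < c.
  by rewrite /S /= rateE lte_fin.
(* On [S] the rate of a suboptimal arm is at most [c] over its gap. Optimal arms get weight 0: their
   gap and their <y, u> vanish wherever the weight is used. *)
have cv (mk : 'I_M.+1 * 'I_K.+1) : exists l : R, 0 <= l /\
    (0 < gap A theta mk.1 mk.2 -> rate n mk.1 mk.2 @[n --> G] --> l).
  case: mk => m k /=; have [g0|gn0] := ltP 0 (gap A theta m k); last by exists 0.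
  have [|l cvl] := @ultra_bounded_cvg R nat G GU (fun n => rate n m k)
    (c / gap A theta m k).
    apply: filterS GS => n /ratelt/ltW rc; rewrite /= ger0_norm//.
    rewrite ler_pdivlMr//; apply: le_trans rc.
    rewrite (bigD1 m)//= (bigD1 k)//= -addrA lerDl addr_ge0// sumr_ge0// => i _.
      by rewrite mulr_ge0 ?gap_ge0.
    by rewrite sumr_ge0// => j _; rewrite mulr_ge0 ?gap_ge0.
  exists l; split => //; rewrite -(cvg_lim _ cvl)//.
  apply: limr_ge; first by apply/cvg_ex; exists l.
  exact: nearW.
have [al alP] := choice cv; pose alpha m k := al (m, k).
have alpha_ge0 m k : 0 <= alpha m k by have [] := alP (m, k).
have alpha_cvg m k : 0 < gap A theta m k -> rate n m k @[n --> G] --> alpha m k.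
  by have [_] := alP (m, k).
have gap_eq0 m k : ~~ (0 < gap A theta m k) -> gap A theta m k = 0.
  by rewrite -leNgt => g0; apply/eqP; rewrite eq_le g0 gap_ge0.
have cost : \sum_m \sum_k alpha m k * gap A theta m k <= c.
  have cc : \sum_m \sum_k rate n m k * gap A theta m k @[n --> G] -->
      \sum_m \sum_k alpha m k * gap A theta m k.
    apply: cvg_sumr => m _; apply: cvg_sumr => k _.
    have [g0|/gap_eq0 ->] := boolP (0 < gap A theta m k).
      by apply: cvgM; [exact: alpha_cvg|exact: cvg_cst].
    by under eq_fun do rewrite mulr0; rewrite mulr0; exact: cvg_cst.
  rewrite -(cvg_lim _ cc)//; apply: limr_le; first by apply/cvg_ex; eexists;
    exact: cc.
  by apply: filterS GS => n /ratelt/ltW.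
apply: (@le_trans _ _ (\sum_m \sum_k alpha m k * gap A theta m k)%:E);
  last by rewrite lee_fin.
apply: complexity_le_cost => // m k u gap0 xu optu.
have form_cvg : dform A (rate n) u u @[n --> G] --> dform A alpha u u.
  apply: cvg_sumr => i _; apply: cvg_sumr => j _.
  have [g0|/gap_eq0/optu ->] := boolP (0 < gap A theta i j).
    by apply: cvgM; [exact: alpha_cvg|exact: cvg_cst].
  by under eq_fun do rewrite !mulr0; rewrite !mulr0; exact: cvg_cst.
set D := gap A theta m k in gap0 *; set Q := dform A alpha u u in form_cvg *.
have Q0 : 0 <= Q by exact: dform_ge0.
have lower (s : R) : D < s -> 1 <= s ^+ 2 / 2 * Q.
  move=> Ds; apply/ler_addgt0Pr => e e0; rewrite -lerBlDr.
  have sc : s ^+ 2 / 2 * dform A (rate n) u u @[n --> G] --> s ^+ 2 / 2 * Q.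
    by apply: cvgM => //; exact: cvg_cst.
  rewrite -(cvg_lim _ sc)//; apply: limr_ge; first by apply/cvg_ex; eexists;
    exact: sc.
  by apply: Goo; exact: (rate_lower_bound Ds xu optu e0).
apply/ler_addgt0Pr => e e0.
(* Slightly above the gap [D], with s^2 / 2 * [Q] at most [e] more than D^2 / 2 * [Q]. *)
pose s := Num.sqrt (D ^+ 2 + 2 * e / (Q + 1)).
have t0 : 0 < 2 * e / (Q + 1) by rewrite divr_gt0 ?mulr_gt0// ltr_wpDl.
have ss : s ^+ 2 = D ^+ 2 + 2 * e / (Q + 1).
  by rewrite sqr_sqrtr// addr_ge0 ?sqr_ge0// ltW.
have /lower : D < s.
  rewrite -(@ltr_pXn2r _ 2) ?nnegrE ?sqrtr_ge0 ?(ltW gap0)//.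
  by rewrite ss ltrDl.
move=> /le_trans; apply; rewrite ss.
have -> : (D ^+ 2 + 2 * e / (Q + 1)) / 2 * Q = D ^+ 2 / 2 * Q + e * (Q / (Q + 1)).
  by field; rewrite gt_eqF// ltr_wpDl.
by rewrite lerD2l -[leRHS]mulr1 ler_pM2l// ler_pdivrMr ?ltr_wpDl// mul1r lerDl.
Qed.

End asymptotics.

Theorem theorem3p3 (R : realType) (d M K : nat)
    (A : 'I_M.+1 -> 'I_K.+1 -> 'cV[R]_d)
    (A_inj : forall m, injective (A m))
    (A_span : forall m, (<<codom (A m)>> = fullv)%VS)
    (A_norm : forall m k, norm2 (A m k) <= 1)
    (theta : 'cV[R]_d)
    (p : probability 'I_M.+1 R)
    (p_gt0 : forall m : 'I_M.+1, (0 < p [set m])%E)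
    (unique_best : forall m,
      exists! k, forall j, dot (A m j) theta <= dot (A m k) theta)
    (pi : policy R M K)
    (pi_consistent : consistent A pi) :
  (complexity A theta <=
   limn_einf (fun n => regret A theta p pi n * ((ln n%:R)^-1)%:E))%E.
Proof.
(* Nonnegativity excludes the value -oo for the limit inferior. At n = 0 and n = 1 the logarithm is
   0, and so is its inverse. *)
set u := fun n => _; have u0 n : (0 <= u n)%E.
  rewrite /u regretE -EFinM lee_fin divr_ge0//; last first.
    by case: n => [|n]; [rewrite ln0|rewrite ln_ge0// ler1n].
  apply: sumr_ge0 => m _; apply: sumr_ge0 => k _.
  by rewrite mulr_ge0 ?pulls_ge0 ?gap_ge0.
have main (c : R) : (limn_einf u < c%:E)%E -> (complexity A theta <= c%:E)%E.
  move=> /limn_einf_lt_frequently; exact: complexity_le_of_frequently.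
case E : (limn_einf u) => [r| |]; last 2 first.
- exact: leey.
- have : (limn_einf u < 0%:E)%E by rewrite E ltNyr.
  by move=> /limn_einf_lt_frequently/(_ 0%N)[k _]; rewrite ltNge u0.
apply/lee_addgt0Pr => e e0; rewrite -EFinD; apply: main.
by rewrite E lte_fin ltrDl.
Qed.
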